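(* Let $m>1$ be an integer and $N>0$ a real number. The homogeneous extended triangle map $\tilde T:\mathrm{Dom}(\tilde T)\to \mathrm{Dom}(\tilde T)$ is the natural extension of the homogeneous triangle map $T:\mathrm{Dom}(T)\to\mathrm{Dom}(T)$, with factor map $\psi(\overline\lambda\times\overline k)=\overline\lambda$.
   Context: Write $\overline\lambda=(\lambda_0,\dots,\lambda_m)$ and $\overline k=[k_0,\dots,k_m]$. Let $\triangle=\{\overline\lambda\in\mathbb R^{m+1}:\lambda_0>\cdots>\lambda_m>0\}$, and let $\triangle_0,\triangle_1,\triangle_D$ be the subsets of $\triangle$ where $\lambda_0<\lambda_1+\lambda_m$, $\lambda_0>\lambda_1+\lambda_m$, $\lambda_0=\lambda_1+\lambda_m$, respectively. The homogeneous triangle map $T:\triangle_0\cup\triangle_1\to\triangle$ is $$T(\overline\lambda)=(\lambda_1,\lambda_2,\dots,\lambda_m,\lambda_0-\lambda_1)\ \text{on }\triangle_0,\qquad T(\overline\lambda)=(\lambda_0-\lambda_m,\lambda_1,\dots,\lambda_m)\ \text{on }\triangle_1.$$ $\mathrm{Dom}(T)$ is the set of $\overline\lambda\in\triangle$ with $T^n(\overline\lambda)\notin\triangle_D$ for all $n\ge 0$. Let $\mathcal P_m(N)=\{\overline\lambda\times\overline k:\overline\lambda\in\triangle,\ k_i>0,\ \sum_{i=0}^m\lambda_ik_i=N\}$. The extended triangle map $\tilde T$ is defined on points of $\mathcal P_m(N)$ with $\overline\lambda\in\triangle_0\cup\triangle_1$ by $$\tilde T(\overline\lambda\times\overline k)=(\lambda_1,\dots,\lambda_m,\lambda_0-\lambda_1)\times[k_0+k_1,k_2,\dots,k_m,k_0]\quad\text{if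 }\overline\lambda\in\triangle_0,$$ $$\tilde T(\overline\lambda\times\overline k)=(\lambda_0-\lambda_m,\lambda_1,\dots,\lambda_m)\times[k_0,\dots,k_{m-1},k_0+k_m]\quad\text{if }\overline\lambda\in\triangle_1.$$ $\mathrm{Dom}(\tilde T)$ is the set of points of $\mathcal P_m(N)$ none of whose forward iterates under $\tilde T$ has $\overline\lambda$-component in $\triangle_D$. Measures: using coordinates $(\lambda_0,\dots,\lambda_m,k_1,\dots,k_m)$ on $\mathcal P_m(N)$ (with $k_0=(N-\sum_{i\ge1}\lambda_ik_i)/\lambda_0$), $\mathrm{Dom}(\tilde T)$ carries the measure $\mu=\lambda_0^{-1}\,d\lambda_0\cdots d\lambda_m\,dk_1\cdots dk_m$ and $\mathrm{Dom}(T)$ carries $\nu=\psi_*\mu$, both on Borel sets. Natural extension: given a measure preserving map $S:Y\to Y$ on $(Y,\mathcal G,\nu)$, a measure preserving map $R:X\to X$ on $(X,\mathcal F,\mu)$ is the natural extension of $S$, with factor map $\psi:X\to Y$, if (up to null sets): (1) $R$ is one-to-one; (2) $\psi$ is onto (with $\psi_*\mu=\nu$), and $\mathcal F$ is the $\sigma$-algebra generated by all $R^k\psi^{-1}(\mathcal G)$, $k\ge0$; (3) $\psi\circ R=S\circ\psi$; (4) every other such covering factors through $X$: if $R':X'\to X'$ is one-to-one and measure preserving and $\psi':X'\to Y$ is an onto measure preserving map with $\psi'\circ R'=S\circ\psi'$, then there is a measure preserving $\varphi:X'\to X$ with $\varphi\circ R'=R\circ\varphi$ and $\psi\circ\varp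hi=\psi'$.
   Formalization: ''One-to-one'' is taken to mean: off a null set, injective and sending measurable sets to measurable sets (automatic on standard spaces); without this, clause (4) fails over arbitrary measure spaces, e.g. for Dom(T~) with the smaller σ-algebra pulled back by ψ. *)

(* Defs.v *)
From HB Require Import structures.
From mathcomp Require Import all_boot all_order all_algebra.
From mathcomp Require Import all_classical all_reals all_analysis.
From mathcomp Require Import measurable_realfun.

Set Implicit Arguments.
Unset Strict Implicit.
Unset Printing Implicit Defensive.

Import Order.TTheory GRing.Theory Num.Theory.
Import numFieldNormedType.Exports.
Local Open Scope classical_set_scope.
Local Open Scope ring_scope.

Section lebesgue_tuple.
Context {R : realType}.



Definition tcons n (p : R * n.-tuple R) : n.+1.-tuple R :=
  [tuple of p.1 :: p.2].

Lemma measurable_tcons n : measurable_fun setT (@tcons n).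
Proof. exact: measurable_cons. Qed.

Section step.
Variables (n : nat) (mu : {sigma_finite_measure set (n.-tuple R) -> \bar R}).

Definition lebn_step : set (n.+1.-tuple R) -> \bar R :=
  pushforward (lebesgue_measure \x mu)%E (@tcons n).

Let preim (A : set (n.+1.-tuple R)) :
  measurable A -> measurable (@tcons n @^-1` A).
Proof.
by move=> mA; rewrite -[X in measurable X]setTI; exact: measurable_tcons.
Qed.

Let step0 : lebn_step set0 = 0%E.
Proof. by rewrite /lebn_step /pushforward preimage_set0 measure0. Qed.

Let step_ge0 A : (0 <= lebn_step A)%E.
Proof. by rewrite /lebn_step /pushforward; exact: measure_ge0. Qed.

Let step_sigma_additive : semi_sigma_additive lebn_step.
Proof.
move=> F mF tF mUF; rewrite /lebn_step /pushforward preimage_bigcup.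
apply: measure_semi_sigma_additive.
- by move=> k; exact: preim.
- apply/trivIsetP => /= i j _ _ ij; rewrite -preimage_setI.
  by move/trivIsetP : tF => /(_ _ _ _ _ ij) ->//; rewrite preimage_set0.
- by rewrite -preimage_bigcup; exact: preim.
Qed.

HB.instance Definition _ := isMeasure.Build _ _ _ lebn_step
  step0 step_ge0 step_sigma_additive.

Let step_sigma_finite : sigma_finite setT lebn_step.
Proof.
have /sigma_finiteP[F [TF ndF Foo]] := sigma_finiteT (@lebesgue_measure R).
have /sigma_finiteP[G [TG ndG Goo]] := sigma_finiteT mu.
pose g (t : n.+1.-tuple R) : R * n.-tuple R := (thead t, [tuple of behead t]).
have mg : measurable_fun setT g.
  apply: measurable_fun_pair; last exact: measurable_behead.
  exact: measurable_tnth.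
have gK : cancel g (@tcons n) by move=> t; rewrite /tcons/= -tuple_eta.
have tK : cancel (@tcons n) g.
  by move=> [x t]; rewrite /g /tcons theadE; congr pair; exact/val_inj.
exists (fun k => g @^-1` (F k `*` G k)).
  rewrite -preimage_bigcup (_ : \bigcup_k _ = setT) ?preimage_setT//.
  rewrite -subTset => -[x t] _.
  have [i _ Fix] : (\bigcup_i F i) x by rewrite -TF.
  have [j _ Gjt] : (\bigcup_i G i) t by rewrite -TG.
  exists (maxn i j) => //; split.
  - by move: x Fix; exact/subsetPset/ndF/leq_maxl.
  - by move: t Gjt; exact/subsetPset/ndG/leq_maxr.
move=> k; have [mF Fk] := Foo k; have [mG Gk] := Goo k; split.
  by rewrite -[X in measurable X]setTI; apply: mg => //; exact: measurableX.
rewrite /lebn_step /pushforward -comp_preimage.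
rewrite (_ : g \o @tcons n = id); last by apply/funext => x; exact: tK.
by rewrite product_measure1E// lte_mul_pinfty// ge0_fin_numE.
Qed.

HB.instance Definition _ := Measure_isSigmaFinite.Build _ _ _ lebn_step
  step_sigma_finite.

End step.

(* n-dimensional Lebesgue measure, as an iterated product. *)
Fixpoint lebn n : {sigma_finite_measure set (n.-tuple R) -> \bar R} :=
  match n with
  | 0 => dirac [tuple]
  | n'.+1 => lebn_step (lebn n')
  end.

End lebesgue_tuple.

Section natural_extension.
Context {R : realType}.

(* A measure space whose points form a measurable subset [ms_dom] of an ambient
   measurable type: its sigma-algebra consists of the measurable subsets of
   [ms_dom], and only the values of [ms_mu] on these sets matter. *)
Record measure_space := MeasureSpace {
  ms_display : measure_display ;
  ms_type :> measurableType ms_display ;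
  ms_dom : set ms_type ;
  ms_mu : {measure set ms_type -> \bar R} ;
  measurable_ms_dom : measurable ms_dom }.

Arguments ms_dom : clear implicits.
Arguments ms_mu : clear implicits.

Implicit Types X Y : measure_space.

Definition ms_measurable X : set (set X) :=
  [set A | measurable A /\ A `<=` ms_dom X].

Definition ms_ae X (P : X -> Prop) : Prop :=
  {ae ms_mu X, forall x, ms_dom X x -> P x}.

Definition ms_eq_ae X (A B : set X) : Prop := ms_ae (fun x => A x <-> B x).

Definition measure_preserving X Y (f : X -> Y) : Prop :=
  [/\ set_fun (ms_dom X) (ms_dom Y) f,
      measurable_fun (ms_dom X) f
    & forall B, ms_measurable B ->
        ms_mu X (ms_dom X `&` f @^-1` B) = ms_mu Y B].

(* Modulo a null set, f is injective and maps measurable sets to measurable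
   sets.  Between standard Borel spaces the second clause follows from the
   first (Lusin-Souslin).  In an arbitrary measure space it is needed: if F on
   X is the natural extension of S on Y, then X with the smaller sigma-algebra
   pulled back from Y still carries the injective measure preserving map F and
   still covers S, but in general it does not factor through X. *)
Definition one_to_one X (f : X -> X) : Prop :=
  exists2 E : set X, ms_measurable E /\ (ms_mu X).-negligible (ms_dom X `\` E)
    & {in E &, injective f} /\
      (forall A, measurable A -> A `<=` E -> measurable (f @` A)).

Definition onto X Y (f : X -> Y) : Prop :=
  (ms_mu Y).-negligible (ms_dom Y `\` f @` ms_dom X).

Definition forward_images X Y (F : X -> X) (psi : X -> Y) : set (set X) :=
  [set A | exists (k : nat) (B : set Y),
    ms_measurable B /\ A = iter k F @` (ms_dom X `&` psi @^-1` B)].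

Definition forward_generated X Y (F : X -> X) (psi : X -> Y) : Prop :=
  let G := <<s ms_dom X, forward_images F psi >> in
  (forall A, ms_measurable A -> exists2 B, G B & ms_eq_ae A B) /\
  (forall B, G B -> exists2 A, ms_measurable A & ms_eq_ae A B).

Definition invertible_cover X Y (S : Y -> Y) (F : X -> X) (psi : X -> Y) :
    Prop :=
  [/\ measure_preserving F, one_to_one F, measure_preserving psi, onto psi
    & ms_ae (fun x => psi (F x) = S (psi x))].

Definition natural_extension X Y (S : Y -> Y) (F : X -> X) (psi : X -> Y) :
    Prop :=
  [/\ measure_preserving S, invertible_cover S F psi, forward_generated F psi
    & forall (X' : measure_space) (F' : X' -> X') (psi' : X' -> Y),
        invertible_cover S F' psi' ->
        exists phi : X' -> X,
          [/\ measure_preserving phi,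
              ms_ae (fun x => phi (F' x) = F (phi x))
            & ms_ae (fun x => psi (phi x) = psi' x)]].

End natural_extension.
Arguments measure_space : clear implicits.
Arguments natural_extension {R} X Y S F psi.

Section measurability.
Context {R : realType}.

Lemma measurable_nth n (i : nat) :
  measurable_fun setT (fun l : n.-tuple R => l`_i).
Proof.
have [ni|ni] := ltnP i n; last first.
  rewrite (_ : (fun _ => _) = cst 0); first exact: measurable_cst.
  by apply/funext => l; rewrite nth_default ?size_tuple.
rewrite (_ : (fun _ => _) = (fun l : n.-tuple R => tnth l (Ordinal ni))).
  exact: measurable_tnth.
by apply/funext => l; rewrite (tnth_nth 0).
Qed.

Lemma measurable_lt d (T : measurableType d) (f g : T -> R) :
  measurable_fun setT f -> measurable_fun setT g ->
  measurable [set x | f x < g x].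
Proof.
move=> mf mg.
rewrite (_ : [set _ | _] = setT `&` (fun x => f x < g x) @^-1` [set true]).
  exact: measurable_fun_ltr.
by rewrite setTI.
Qed.

Lemma measurable_mem d (T : measurableType d) d' (T' : measurableType d')
    (f : T -> T') (A : set T') :
  measurable_fun setT f -> measurable A ->
  measurable_fun setT (fun x => f x \in A).
Proof.
move=> mf mA; apply: (@measurable_fun_bool _ _ _ _ true).
rewrite setTI (_ : _ @^-1` _ = f @^-1` A).
  by rewrite -[X in measurable X]setTI; exact: mf.
by apply/seteqP; split => x /=; [move/set_mem|exact: mem_set].
Qed.

Lemma measurable_iter d (T : measurableType d) (f : T -> T) n :
  measurable_fun setT f -> measurable_fun setT (iter n f).
Proof.
move=> mf; elim: n => [|n IHn]; first exact: measurable_id.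
exact: (measurableT_comp mf IHn).
Qed.

Lemma measurable_invr : measurable_fun setT (@GRing.inv R).
Proof.
rewrite -(setvU [set (0 : R)]); apply/measurable_funU.
- by apply: measurableC; exact: measurable_set1.
- exact: measurable_set1.
split; last exact: measurable_fun_set1.
apply: open_continuous_measurable_fun.
  by apply: closed_openC; exact: closed_eq.
by move=> x; rewrite inE => /eqP x0; exact: inv_continuous.
Qed.

End measurability.

Section triangle_map.
Context {R : realType} {m : nat}.

Local Notation vec := (m.+1.-tuple R).
Local Notation point := (m.+1.-tuple R * m.+1.-tuple R)%type.

Implicit Types (l k : vec) (x : point).

Definition triangle : set vec :=
  [set l | (forall i, (i < m)%N -> l`_i.+1 < l`_i) /\ 0 < l`_m].

Definition triangle0 : set vec :=
  triangle `&` [set l | l`_0 < l`_1 + l`_m].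

Definition triangle1 : set vec :=
  triangle `&` [set l | l`_0 > l`_1 + l`_m].

Definition triangleD : set vec :=
  triangle `&` [set l | l`_0 = l`_1 + l`_m].

Definition step_l0 l : vec :=
  [tuple if (i < m)%N then l`_i.+1 else l`_0 - l`_1 | i < m.+1].

Definition step_l1 l : vec :=
  [tuple if (i == 0 :> nat) then l`_0 - l`_m else l`_i | i < m.+1].

Definition step_k0 k : vec :=
  [tuple if (i == 0 :> nat) then k`_0 + k`_1
         else if (i < m)%N then k`_i.+1 else k`_0 | i < m.+1].

Definition step_k1 k : vec :=
  [tuple if (i < m)%N then k`_i else k`_0 + k`_m | i < m.+1].

(* Both maps are extended by the identity outside their domains of
   definition. *)
Definition triangle_map l : vec :=
  if l \in triangle0 then step_l0 l
  else if l \in triangle1 then step_l1 l else l.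

Definition ext_triangle_map x : point :=
  if x.1 \in triangle0 then (step_l0 x.1, step_k0 x.2)
  else if x.1 \in triangle1 then (step_l1 x.1, step_k1 x.2) else x.

Definition Dom_T : set vec :=
  [set l | triangle l /\ forall n, ~ triangleD (iter n triangle_map l)].

Definition Pm (N : R) : set point :=
  [set x : point | [/\ triangle x.1, forall i : 'I_m.+1, 0 < x.2`_i
    & \sum_(i < m.+1) x.1`_i * x.2`_i = N]].

Definition Dom_eT (N : R) : set point :=
  [set x | Pm N x /\ forall n, ~ triangleD (iter n ext_triangle_map x).1].

(* The point of Pm N with coordinates c = ((l_0, ..., l_m), (k_1, ..., k_m)). *)
Definition Pm_point (N : R) (c : vec * m.-tuple R) : point :=
  (c.1, [tuple of
     (N - \sum_(i < m) c.1`_i.+1 * c.2`_i) / c.1`_0 :: c.2]).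

Definition mu_eT (N : R) (A : set point) : \bar R :=
  (\int[lebn m.+1 \x lebn m]_(c in Pm_point N @^-1` (A `&` Dom_eT N))
     (c.1`_0)^-1%:E)%E.

Lemma measurable_triangle : measurable triangle.
Proof.
rewrite (_ : triangle = (\bigcap_(i in [set i | (i < m)%N])
    [set l : vec | l`_i.+1 < l`_i]) `&`
    [set l : vec | 0 < l`_m])//.
apply: measurableI; last by apply: measurable_lt => //; exact: measurable_nth.
apply: bigcap_measurableType => i _.
by apply: measurable_lt; exact: measurable_nth.
Qed.

Lemma measurable_nthD i j :
  measurable_fun setT (fun l : vec => l`_i + l`_j).
Proof. by apply: measurable_funD; exact: measurable_nth. Qed.

Lemma measurable_nthB i j :
  measurable_fun setT (fun l : vec => l`_i - l`_j).
Proof. by apply: measurable_funB; exact: measurable_nth. Qed.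

Lemma measurable_triangle0 : measurable triangle0.
Proof.
apply: measurableI; first exact: measurable_triangle.
by apply: measurable_lt; [exact: measurable_nth|exact: measurable_nthD].
Qed.

Lemma measurable_triangle1 : measurable triangle1.
Proof.
apply: measurableI; first exact: measurable_triangle.
by apply: measurable_lt; [exact: measurable_nthD|exact: measurable_nth].
Qed.

Lemma triangleDE : triangleD = triangle `\` (triangle0 `|` triangle1).
Proof.
apply/seteqP; split => [l [tl /= e]|l [tl /= n]].
  by split => // -[[_]|[_]] /=; rewrite e ltxx.
split => //=; apply/eqP; rewrite eq_le !leNgt; apply/andP; split;
  apply/negP => h; apply: n; first by right.
by left.
Qed.

Lemma measurable_triangleD : measurable triangleD.
Proof.
rewrite triangleDE; apply: measurableD; first exact: measurable_triangle.
by apply: measurableU;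
  [exact: measurable_triangle0|exact: measurable_triangle1].
Qed.

Lemma measurable_mktuple (f : 'I_m.+1 -> vec -> R) :
  (forall i, measurable_fun setT (f i)) ->
  measurable_fun setT (fun l => [tuple f i l | i < m.+1]).
Proof.
move=> mf; apply/measurable_fun_tnthP => i.
rewrite (_ : _ \o _ = f i); first exact: mf.
by apply/funext => l /=; rewrite tnth_mktuple.
Qed.

Lemma measurable_step_l0 : measurable_fun setT step_l0.
Proof.
apply: measurable_mktuple => i.
by case: (i < m)%N; [exact: measurable_nth|exact: measurable_nthB].
Qed.

Lemma measurable_step_l1 : measurable_fun setT step_l1.
Proof.
apply: measurable_mktuple => i.
by case: (i == 0 :> nat); [exact: measurable_nthB|exact: measurable_nth].
Qed.

Lemma measurable_step_k0 : measurable_fun setT step_k0.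
Proof.
apply: measurable_mktuple => i.
case: (i == 0 :> nat); first exact: measurable_nthD.
by case: (i < m)%N; exact: measurable_nth.
Qed.

Lemma measurable_step_k1 : measurable_fun setT step_k1.
Proof.
apply: measurable_mktuple => i.
by case: (i < m)%N; [exact: measurable_nth|exact: measurable_nthD].
Qed.

Lemma measurable_triangle_map : measurable_fun setT triangle_map.
Proof.
apply: measurable_fun_ifT.
- by apply: measurable_mem => //; exact: measurable_triangle0.
- exact: measurable_step_l0.
apply: measurable_fun_ifT => //.
- by apply: measurable_mem => //; exact: measurable_triangle1.
- exact: measurable_step_l1.
Qed.

Lemma measurable_ext_triangle_map : measurable_fun setT ext_triangle_map.
Proof.
apply: measurable_fun_ifT.
- by apply: measurable_mem => //; exact: measurable_triangle0.
- by apply: measurable_fun_pair; apply: measurableT_comp => //;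
    [exact: measurable_step_l0|exact: measurable_step_k0].
apply: measurable_fun_ifT => //.
- by apply: measurable_mem => //; exact: measurable_triangle1.
- by apply: measurable_fun_pair; apply: measurableT_comp => //;
    [exact: measurable_step_l1|exact: measurable_step_k1].
Qed.

Lemma measurable_Dom_T : measurable Dom_T.
Proof.
rewrite (_ : Dom_T = triangle `&`
    \bigcap_n ~` (iter n triangle_map @^-1` triangleD)).
  apply: measurableI; first exact: measurable_triangle.
  apply: bigcap_measurableType => n _; apply: measurableC.
  rewrite -[X in measurable X]setTI; apply: measurable_iter => //.
    exact: measurable_triangle_map.
  exact: measurable_triangleD.
by apply/seteqP; split => l [tl h]; split => // n; [move=> _|]; exact: h.
Qed.

Lemma measurable_Pm N : measurable (Pm N).
Proof.
rewrite (_ : Pm N = fst @^-1` triangle `&`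
  ((\bigcap_(i : 'I_m.+1) [set x : point | 0 < x.2`_i]) `&`
   ((fun x => \sum_(i < m.+1) x.1`_i * x.2`_i) @^-1` [set N]))); last first.
  apply/seteqP; split => [x [tx kx sx]|x [tx [kx sx]]].
    by split => //; split => // i _; exact: kx.
  by split => // i; exact: kx.
apply: measurableI.
  rewrite -[X in measurable X]setTI; apply: measurable_fst => //.
  exact: measurable_triangle.
apply: measurableI.
  apply: fin_bigcap_measurable => // i _; apply: measurable_lt => //.
  by apply: (measurableT_comp (measurable_nth _)).
rewrite -[X in measurable X]setTI.
suff : measurable_fun setT (fun x => \sum_(i < m.+1) x.1`_i * x.2`_i).
  by move=> mf; apply: mf => //; exact: measurable_set1.
apply: measurable_sum => i; apply: measurable_funM;
  by apply: (measurableT_comp (measurable_nth _)).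
Qed.

Lemma measurable_Dom_eT N : measurable (Dom_eT N).
Proof.
rewrite (_ : Dom_eT N = Pm N `&`
    \bigcap_n ~` ((fst \o iter n ext_triangle_map) @^-1` triangleD)).
  apply: measurableI; first exact: measurable_Pm.
  apply: bigcap_measurableType => n _; apply: measurableC.
  rewrite -[X in measurable X]setTI; apply: measurableT_comp => //.
    by apply: measurable_iter; exact: measurable_ext_triangle_map.
  exact: measurable_triangleD.
by apply/seteqP; split => l [tl h]; split => // n; [move=> _|]; exact: h.
Qed.

Lemma measurable_Pm_point N : measurable_fun setT (Pm_point N).
Proof.
apply: measurable_fun_pair => //; apply: measurable_cons => //.
apply: measurable_funM.
  apply: measurable_funB => //; apply: measurable_sum => i.
  by apply: measurable_funM; apply: (measurableT_comp (measurable_nth _)).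
apply: (measurableT_comp measurable_invr).
by apply: (measurableT_comp (measurable_nth _)).
Qed.

Let preim N A : measurable A -> measurable (Pm_point N @^-1` (A `&` Dom_eT N)).
Proof.
move=> mA; rewrite -[X in measurable X]setTI; apply: measurable_Pm_point => //.
by apply: measurableI => //; exact: measurable_Dom_eT.
Qed.

Let density_ge0 N A c : (Pm_point N @^-1` (A `&` Dom_eT N)) c ->
  (0 <= (c.1`_0)^-1%:E)%E.
Proof.
move=> [_ [[[dec pos] _ _] _]]; rewrite lee_fin invr_ge0 ltW//.
move: dec pos => /= dec pos.
suff H j : (j <= m)%N -> c.1`_m <= c.1`_(m - j).
  by rewrite (lt_le_trans pos)//; move: (H m (leqnn m)); rewrite subnn.
elim: j => [|j IHj] jm; first by rewrite subn0.
rewrite (le_trans (IHj (ltnW jm)))// ltW//.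
by have := dec (m - j.+1)%N; rewrite subnSK//; apply; exact: leq_subr.
Qed.

Let mu_eT0 N : mu_eT N set0 = 0%E.
Proof. by rewrite /mu_eT set0I preimage_set0 integral_set0. Qed.

Let mu_eT_ge0 N A : (0 <= mu_eT N A)%E.
Proof. by apply: integral_ge0 => c; exact: density_ge0. Qed.

Let mu_eT_sigma_additive N : semi_sigma_additive (mu_eT N).
Proof.
move=> F mF tF mUF; rewrite /mu_eT setI_bigcupl preimage_bigcup.
rewrite ge0_integral_bigcup//=.
- apply: is_cvg_ereal_nneg_natsum_cond => n _ _.
  by apply: integral_ge0 => c; exact: density_ge0.
- by move=> n; exact: preim.
- apply: measurable_funTS; apply/measurable_EFinP.
  apply: (measurableT_comp measurable_invr).
  by apply: (measurableT_comp (measurable_nth _)).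
- by move=> c [n _]; exact: density_ge0.
- apply/trivIsetP => /= i j _ _ ij; rewrite -preimage_setI setIACA.
  by move/trivIsetP : tF => /(_ _ _ _ _ ij) ->//; rewrite set0I preimage_set0.
Qed.

HB.instance Definition _ N := isMeasure.Build _ _ _ (mu_eT N)
  (mu_eT0 N) (mu_eT_ge0 N) (@mu_eT_sigma_additive N).

Definition nu_T (N : R) : set vec -> \bar R :=
  pushforward (mu_eT N) fst.

Let nu_step_l0 N : nu_T N set0 = 0%E.
Proof. by rewrite /nu_T /pushforward preimage_set0 measure0. Qed.

Let nu_T_ge0 N A : (0 <= nu_T N A)%E.
Proof. exact: mu_eT_ge0. Qed.

Let nu_T_sigma_additive N : semi_sigma_additive (nu_T N).
Proof.
have mfst (A : set vec) : measurable A ->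
    measurable (fst @^-1` A : set point).
  by move=> mA; rewrite -[X in measurable X]setTI; exact: measurable_fst.
move=> F mF tF mUF; rewrite /nu_T /pushforward preimage_bigcup.
apply: measure_semi_sigma_additive.
- by move=> k; exact: mfst.
- apply/trivIsetP => /= i j _ _ ij; rewrite -preimage_setI.
  by move/trivIsetP : tF => /(_ _ _ _ _ ij) ->//; rewrite preimage_set0.
- by rewrite -preimage_bigcup; exact: mfst.
Qed.

HB.instance Definition _ N := isMeasure.Build _ _ _ (nu_T N)
  (nu_step_l0 N) (nu_T_ge0 N) (@nu_T_sigma_additive N).

End triangle_map.

Definition space_eT (R : realType) (m : nat) (N : R) : measure_space R :=
  MeasureSpace (mu_eT N : {measure set _ -> \bar R})
    (@measurable_Dom_eT R m N).

Definition space_T (R : realType) (m : nat) (N : R) : measure_space R :=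
  MeasureSpace (nu_T N : {measure set _ -> \bar R})
    (@measurable_Dom_T R m).

(* Main.v *)
Require Import Defs.
From mathcomp Require Import all_boot all_order all_algebra.
From mathcomp Require Import all_classical all_reals all_analysis.
From mathcomp Require Import measurable_realfun ring lra zify.

(** Why the extended map is the natural extension.

    Both inverse branches of [T] are defined on the whole triangle, so a past
    of a point [l] under [T] is an arbitrary sequence of binary choices.  The
    vector [k] stores these choices: a step of the extended map adds entries of
    [k] in such a way that the comparison of [k_0] with [k_m] afterwards tells
    which branch was used ([branch_step]).  Hence the extended map is injective,
    with an explicit inverse [ext_back], and the theorem amounts to the
    statement that the past of [l] determines [k] for almost every point.

    The past determines [k].  Let [V] be the product of the matrices of the
    last [n] steps acting on [k].  Then [k] lies in the cone spanned by the
    columns of [V]; these columns, normalised by their product with [l], are the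
    vertices of a simplex that contains [k] up to the factor [N], and these
    simplices decrease with [n].  For a fixed coordinate, let [a] be the row
    vector [l V], which is the [n]-th preimage of [l], and [b] the row of [V]
    with that coordinate: the coordinates of the vertices are the slopes
    [b_i / a_i].  One more step back in time replaces one of the two vertices of
    index [0] and [m] by their weighted mean and shuffles the others.  Given the
    past so far, the two choices have Lebesgue measures in the ratio
    [a_m : a_0].  With respect to these probabilities the sum of the squares of
    the slopes is a supermartingale, and its mean loss in one step is the
    conditional variance of the slope that is replaced ([expected_spread]).  So
    the energy, a sum of nonnegative gains with these conditional means, is
    finite almost everywhere ([lebn_unbounded_energy]).  When the energy is
    finite the distance of the vertices [0] and [m] tends to zero, and since the
    vertices rotate through these two places the whole simplex shrinks to a
    point ([slopes_contract]).  Therefore the images under [n] steps of the extended map of an arbitrary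
    point above the [n]-th preimage of [l] converge to [(l, k)]
    ([reconstruct]).

    The measure.  Up to a constant, [mu] of a set is the Lebesgue measure of
    the cone obtained by letting [N] decrease to [0] ([lebn2_cone]).  On that
    cone the extended map acts by two unimodular linear maps whose images
    are separated by the sign of [k_0 - k_m], so [mu] is invariant
    ([mu_eT_invariant]).  The same description turns null sets of vectors [k]
    into null sets for [mu] ([mu_eT_unbounded]).

    The rest is soft ([natural_extension_criterion]).  In any invertible
    covering of [T], the sequence of the projections of the preimages of a point
    has a law that depends on [T] and its invariant measure only
    ([history_law]).  The map that rebuilds a point of the extended map from its
    history can thus be applied to the histories of any other covering, and all
    its almost sure properties persist there. *)

Set Implicit Arguments.
Unset Strict Implicit.
Unset Printing Implicit Defensive.

Import Order.TTheory GRing.Theory Num.Theory.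
Import numFieldNormedType.Exports.
Local Open Scope classical_set_scope.
Local Open Scope ring_scope.

(** * Lebesgue measure on tuples *)
Section one_dim.
Context {R : realType}.
Local Notation leb := (@lebesgue_measure R).

Lemma lebesgue_affine (c d : R) (A : set (measurableTypeR R)) : 0 < c -> measurable A ->
  (leb ((fun x => (c * x + d)%R) @^-1` A) = c^-1%:E * leb A)%E.
Proof.
move=> c0 mA.
pose f : R -> measurableTypeR R := fun x : R => c * x + d.
have mf : measurable_fun setT (f : measurableTypeR R -> _).
  by apply: measurable_funD => //; apply: measurable_funM.
have i0 : (0 <= c) by rewrite ltW.
pose mu := mscale (NngNum i0) (pushforward leb f).
suff H : leb A = mu mf A.
  rewrite H /mu /mscale /= /pushforward muleA -EFinM mulVf ?gt_eqF// mul1e.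
  by [].
apply: lebesgue_measure_unique => //= _ [[a b]] _ <-.
rewrite /mu /mscale/= /pushforward.
rewrite (_ : f @^-1` _ = [set` `](a - d) / c, (b - d) / c] ]); last first.
  apply/seteqP; split => x /=; rewrite !in_itv/= ltr_pdivrMr// ler_pdivlMr//;
    by rewrite ltrBlDr lerBrDr /f mulrC.
rewrite !lebesgue_measure_itv/= !lte_fin ltr_pM2r ?invr_gt0// ltrD2r.
case: ifP => ab; last by rewrite mule0.
rewrite -!EFinD -EFinM; congr EFin; field.
by rewrite gt_eqF.
Qed.

Lemma integral_affine (c d : R) (f : R -> \bar R) : 0 < c ->
  measurable_fun setT f -> (forall x, 0 <= f x)%E ->
  (\int[leb]_x f (c * x + d)%R = c^-1%:E * \int[leb]_x f x)%E.
Proof.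
move=> c0 mf f0.
pose g : measurableTypeR R -> measurableTypeR R := fun x => c * x + d.
have mg : measurable_fun setT g.
  by apply: measurable_funD => //; apply: measurable_funM.
have := @ge0_integral_pushforward _ _ _ _ R g mg leb setT f measurableT mf
  (fun y _ => f0 y).
rewrite preimage_setT => <-.
have i0 : (0 <= c^-1) by rewrite invr_ge0 ltW.
rewrite -(@ge0_integral_mscale _ _ _ leb setT measurableT (NngNum i0) f)//.
apply: eq_measure_integral => A mA _ /=.
by rewrite /pushforward lebesgue_affine.
Qed.
End one_dim.

Section lebn_sections.
Context {R : realType}.
Local Notation leb := (@lebesgue_measure R).
Local Open Scope ereal_scope.

Definition cons_tuple {n} (x : R) (t : n.-tuple R) : n.+1.-tuple R := [tuple of x :: t].
Definition rcons_tuple {n} (t : n.-tuple R) (x : R) : n.+1.-tuple R := [tuple of rcons t x].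

Lemma measurable_preimage d1 d2 (T1 : measurableType d1) (T2 : measurableType d2)
    (f : T1 -> T2) (A : set T2) :
  measurable_fun setT f -> measurable A -> measurable (f @^-1` A).
Proof. by move=> mf mA; rewrite -[X in measurable X]setTI; exact: mf. Qed.

Lemma measurable_eq_fun d (T : measurableType d) (f g : T -> R) :
  measurable_fun setT f -> measurable_fun setT g ->
  measurable [set x | f x = g x].
Proof.
move=> mf mg.
rewrite (_ : [set _ | _] = (fun x => f x - g x)%R @^-1` [set 0%R]).
  by apply: measurable_preimage => //; exact: measurable_funB.
apply/seteqP; split => x /= => [->|/eqP]; first by rewrite subrr.
by rewrite subr_eq0 => /eqP.
Qed.

(** The definition of the product measure integrates the sections along the
    first factor; this is the other order of integration. *)
Lemma product_measure_swap d1 d2 (T1 : measurableType d1) (T2 : measurableType d2)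
    (m1 : {sigma_finite_measure set T1 -> \bar R})
    (m2 : {sigma_finite_measure set T2 -> \bar R}) A : measurable A ->
  (m1 \x m2) A = \int[m2]_y m1 (ysection A y).
Proof.
move=> mA; rewrite (@product_measure_unique _ _ _ _ _ m1 m2 (m1 \x^ m2)%E)//.
by move=> B C mB mC; exact: product_measure2E.
Qed.

Lemma lebnSl n (A : set (n.+1.-tuple R)) :
  lebn n.+1 A = \int[leb]_x lebn n [set t | A (cons_tuple x t)].
Proof.
rewrite /= /lebn_step /pushforward /product_measure1.
apply: eq_integral => x _ /=; congr (lebn n _).
by apply/seteqP; split => t; rewrite /xsection /= inE.
Qed.

Lemma lebnSr n (A : set (n.+1.-tuple R)) : measurable A ->
  lebn n.+1 A = \int[lebn n]_t leb [set x | A (cons_tuple x t)].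
Proof.
move=> mA; rewrite /= /lebn_step /pushforward product_measure_swap; last first.
  by apply: measurable_preimage => //; exact: measurable_tcons.
apply: eq_integral => x _ /=; congr (leb _).
by apply/seteqP; split => t; rewrite /ysection /= inE.
Qed.

(** Shears of the first coordinate and the rotation of the coordinates are the
    only two transformations needed: the linear maps of both branches are
    products of them, so no determinant has to be computed. *)
Definition shear {n} (phi : n.-tuple R -> R) (s : n.+1.-tuple R) : n.+1.-tuple R :=
  cons_tuple (thead s + phi [tuple of behead s])%R [tuple of behead s].

Lemma measurable_shear n (phi : n.-tuple R -> R) : measurable_fun setT phi ->
  measurable_fun setT (shear phi).
Proof.
move=> mphi; apply: measurable_cons; last exact: measurable_behead.
apply: measurable_funD; first exact: measurable_tnth.
by apply: (measurableT_comp mphi); exact: measurable_behead.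
Qed.

Lemma shear_cons n (phi : n.-tuple R -> R) x t :
  shear phi (cons_tuple x t) = cons_tuple (x + phi t)%R t.
Proof.
rewrite /shear /cons_tuple theadE; apply: val_inj => /=.
by congr ((_ + phi _)%R :: _); apply: val_inj.
Qed.

(** For a fixed tail, a shear is a translation of the first coordinate. *)
Lemma lebn_shear n (phi : n.-tuple R -> R) A : measurable_fun setT phi ->
  measurable A -> lebn n.+1 (shear phi @^-1` A) = lebn n.+1 A.
Proof.
move=> mphi mA; rewrite !lebnSr//; last first.
  by apply: measurable_preimage => //; exact: measurable_shear.
apply: eq_integral => t _.
have mAt : measurable [set x : measurableTypeR R | A (cons_tuple x t)].
  apply: (@measurable_preimage _ _ _ _ (fun x => cons_tuple x t)) => //.
  exact: measurable_cons.
have := lebesgue_affine (phi t) ltr01 mAt; rewrite invr1 mul1e => <-.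
congr (leb _); apply/seteqP.
by split => x /=; rewrite shear_cons mul1r.
Qed.

Definition rot_tuple {n} (s : n.+1.-tuple R) : n.+1.-tuple R :=
  rcons_tuple [tuple of behead s] (thead s).

Lemma measurable_rcons d (T : measurableType d) n (f : T -> n.-tuple R) (g : T -> R) :
  measurable_fun setT f -> measurable_fun setT g ->
  measurable_fun setT (fun x => rcons_tuple (f x) (g x)).
Proof.
move=> mf mg; apply/measurable_fun_tnthP => i.
have [ni|ni] := ltnP i n.
  rewrite (_ : _ \o _ = (fun x => tnth (f x) (Ordinal ni))).
    by move/measurable_fun_tnthP : mf; apply.
  apply/funext => x /=; rewrite !(tnth_nth 0%R) /= nth_rcons size_tuple ni.
  by [].
rewrite (_ : _ \o _ = g)//; apply/funext => x /=.
rewrite !(tnth_nth 0%R) /= nth_rcons size_tuple ltnNge ni/= ifT//.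
by rewrite eqn_leq ni andbT -ltnS.
Qed.

Lemma measurable_rot_tuple n : measurable_fun setT (@rot_tuple n).
Proof. by apply: measurable_rcons; [exact: measurable_behead|exact: measurable_tnth]. Qed.

(** Moving the first coordinate past all the others is an exchange with the
    second one, which is Tonelli's theorem, followed by the rotation of the
    remaining coordinates. *)
Lemma lebn_rot n A : measurable A -> lebn n.+1 (rot_tuple @^-1` A) = lebn n.+1 A.
Proof.
elim: n A => [|n IH] A mA.
  congr (lebn 1 _); apply/seteqP.
  by split => s /=; rewrite (_ : rot_tuple s = s)//; apply: val_inj => /=;
    rewrite [in RHS](tuple_eta s) /=; case: s => -[|x []].
pose B : set ((R * R) * n.-tuple R) :=
  [set z | A (cons_tuple z.1.2 (rcons_tuple z.2 z.1.1))].
have mB : measurable B.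
  apply: (@measurable_preimage _ _ _ _
    (fun z : (R * R) * n.-tuple R => cons_tuple z.1.2 (rcons_tuple z.2 z.1.1))) => //.
  apply: measurable_cons; first by apply: (measurableT_comp measurable_snd).
  by apply: measurable_rcons => //; apply: (measurableT_comp measurable_fst).
pose F (z : R * R) := lebn n [set t | B (z, t)].
have mF : measurable_fun setT F.
  have := @measurable_fun_xsection _ _ (R * R)%type (n.-tuple R) R (lebn n) B mB.
  congr measurable_fun; apply/funext => z; rewrite /F /=; congr (lebn n _).
  by apply/seteqP; split => t; rewrite /xsection /= inE.
transitivity (\int[leb]_x \int[leb]_y F (x, y)).
  rewrite lebnSl; apply: eq_integral => x _; rewrite lebnSl.
  apply: eq_integral => y _; rewrite /F; congr (lebn n _).
  apply/seteqP; split => t; rewrite /B /=;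
  suff -> : rot_tuple (cons_tuple x (cons_tuple y t)) =
    cons_tuple y (rcons_tuple t x) by [];
  by apply: val_inj.
transitivity (\int[leb]_y \int[leb]_x F (x, y)).
  exact: (@fubini_tonelli _ _ _ _ R leb leb F mF).
rewrite lebnSl; apply: eq_integral => y _.
rewrite -IH; last first.
  by apply: (@measurable_preimage _ _ _ _ (fun t => cons_tuple y t)) => //; exact: measurable_cons.
rewrite lebnSl; apply: eq_integral => x _; congr (lebn n _).
apply/seteqP; split => t; rewrite /B /=;
suff -> : rot_tuple (cons_tuple x t) = rcons_tuple t x by [];
by apply: val_inj.
Qed.

Definition scale_tuple {n} (c : R) (t : n.-tuple R) : n.-tuple R :=
  [tuple of map (fun x => c * x)%R t].

Lemma measurable_scale_tuple d (T : measurableType d) n (c : T -> R) (f : T -> n.-tuple R) :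
  measurable_fun setT c -> measurable_fun setT f ->
  measurable_fun setT (fun x => scale_tuple (c x) (f x)).
Proof.
move=> mc mf; apply/measurable_fun_tnthP => i.
rewrite (_ : _ \o _ = (fun x => c x * tnth (f x) i)%R).
  by apply: measurable_funM => //; move/measurable_fun_tnthP : mf; apply.
by apply/funext => x /=; rewrite tnth_map.
Qed.

(** One factor [c^-1] per coordinate, from [integral_affine]. *)
Lemma lebn_scale n (c : R) A : (0 < c)%R -> measurable A ->
  lebn n (scale_tuple c @^-1` A) = ((c ^+ n)^-1)%:E * lebn n A.
Proof.
move=> c0; elim: n A => [|n IH] A mA.
  rewrite expr0 invr1 mul1e; congr (lebn 0 _); apply/seteqP.
  by split => s /=; rewrite (_ : scale_tuple c s = s)//; rewrite (tuple0 s); apply: val_inj.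
have mAx x : measurable [set t | A (cons_tuple x t)].
  by apply: (@measurable_preimage _ _ _ _ (fun t => cons_tuple x t)) => //; exact: measurable_cons.
pose F x := lebn n [set t | A (cons_tuple x t)].
have mF : measurable_fun setT F.
  have mB := measurable_preimage (@measurable_tcons R n) mA.
  have := @measurable_fun_xsection _ _ R (n.-tuple R) R (lebn n) _ mB.
  congr measurable_fun; apply/funext => z; rewrite /F /=; congr (lebn n _).
  by apply/seteqP; split => t; rewrite /xsection /= inE.
rewrite lebnSl; transitivity (\int[leb]_x (((c ^+ n)^-1)%:E * F (c * x + 0)%R)).
  apply: eq_integral => x _; rewrite -IH//; congr (lebn n _).
  apply/seteqP; split => t; rewrite /= addr0;
  suff -> : scale_tuple c (cons_tuple x t) = cons_tuple (c * x)%R (scale_tuple c t) by [];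
  by apply: val_inj.
rewrite ge0_integralZl//; last 2 first.
- apply: (@measurableT_comp _ _ _ _ _ _ F) => //.
  by apply: measurable_funD => //; apply: measurable_funM.
- by rewrite lee_fin invr_ge0 exprn_ge0// ltW.
by rewrite integral_affine// -lebnSl muleA -EFinM exprSr invfM.
Qed.

Definition box {n} (c : n.-tuple R) : set (n.-tuple R) :=
  [set t | forall i, (0 < tnth t i < tnth c i)%R].

Lemma measurable_box n (c : n.-tuple R) : measurable (box c).
Proof.
rewrite (_ : box c = \bigcap_(i : 'I_n) ((fun t => tnth t i) @^-1` `]0%R, tnth c i[)).
  apply: fin_bigcap_measurable => // i _; apply: measurable_preimage.
    exact: measurable_tnth.
  exact: measurable_itv.
apply/seteqP; split => t H i; first by move=> _; rewrite /= in_itv/=; exact: H.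
by have := H i I; rewrite /= in_itv.
Qed.

Lemma lebn_box n (c : n.-tuple R) : (forall i, 0 < tnth c i)%R ->
  lebn n (box c) = (\prod_(i < n) tnth c i)%:E.
Proof.
elim: n c => [|n IH] c c0.
  rewrite big_ord0 /= diracE mem_set//.
  by move=> i; case: i.
have [x [c' cE]] : exists x c', c = cons_tuple x c'.
  by exists (thead c), [tuple of behead c]; rewrite [LHS]tuple_eta; apply: val_inj.
rewrite {c}cE in c0 *; set c := cons_tuple x c' in c0 *.
have cS i : tnth c (lift ord0 i) = tnth c' i by rewrite /c !(tnth_nth 0%R).
have x0 : (0 < x)%R by have := c0 ord0; rewrite /c (tnth_nth 0%R).
rewrite /= /lebn_step /pushforward (_ : _ @^-1` _ = `]0%R, x[%classic `*` box c').
  rewrite product_measure1E; [|exact: measurable_itv|exact: measurable_box].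
  rewrite [X in X * _]lebesgue_measure_itv/= lte_fin x0 oppr0 addr0 IH.
    rewrite -EFinM big_ord_recl; congr (_ * _)%:E.
    by apply: eq_bigr => i _; rewrite cS.
  by move=> i; rewrite -cS.
apply/seteqP; split => -[y t] /=.
  move=> H; split; first by have := H ord0; rewrite /= in_itv/= !(tnth_nth 0%R).
  by move=> i; have := H (lift ord0 i); rewrite cS !(tnth_nth 0%R).
move=> [/=]; rewrite in_itv/= => Hy H i.
case: (unliftP ord0 i) => [j ->|->]; last by rewrite !(tnth_nth 0%R).
have -> : tnth (tcons (y, t)) (lift ord0 j) = tnth t j by rewrite !(tnth_nth 0%R).
by rewrite cS; exact: H.
Qed.

End lebn_sections.

(** * The two branches and their transposes *)
Section steps.
Context {R : realType} {m : nat}.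
Local Notation vec := (m.+1.-tuple R).
Implicit Types (l k a b : vec) (w : bool).

Lemma eq_vec (s t : vec) : (forall i, (i <= m)%N -> s`_i = t`_i) -> s = t.
Proof.
move=> H; apply: eq_from_tnth => i; rewrite !(tnth_nth 0); apply: H.
by rewrite -ltnS.
Qed.

Lemma nth_mktuple_nat (f : nat -> R) i : (i <= m)%N -> [tuple f j | j < m.+1]`_i = f i.
Proof. by move=> im; rewrite (nth_mktuple _ _ (Ordinal (im : (i < m.+1)%N))). Qed.

Definition step_l w l := if w then step_l0 l else step_l1 l.
Definition step_k w k := if w then step_k0 k else step_k1 k.

(** Here and below [true] stands for the branch of [triangle0] and [false] for
    that of [triangle1].  [dual w] is the inverse of [step_l w], that is, an
    inverse branch of [T]; it is also the action on row vectors of the matrix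
    of [step_k w], see [dot_dual]. *)
Definition dual w a : vec :=
  [tuple if i == 0 :> nat then a`_0 + a`_m else if w then a`_i.-1 else a`_i
   | i < m.+1].

(** The inverse of [step_k w]. *)
Definition back w k : vec :=
  if w then
    [tuple if i == 0 :> nat then k`_m
           else if i == 1 :> nat then k`_0 - k`_m else k`_i.-1 | i < m.+1]
  else [tuple if (i < m)%N then k`_i else k`_m - k`_0 | i < m.+1].

Lemma nth_step_l0 l i : (i <= m)%N ->
  (step_l0 l)`_i = if (i < m)%N then l`_i.+1 else l`_0 - l`_1.
Proof. exact: (@nth_mktuple_nat (fun i => if (i < m)%N then l`_i.+1 else l`_0 - l`_1)). Qed.

Lemma nth_step_l1 l i : (i <= m)%N ->
  (step_l1 l)`_i = if (i == 0)%N then l`_0 - l`_m else l`_i.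
Proof. exact: (@nth_mktuple_nat (fun i => if (i == 0)%N then l`_0 - l`_m else l`_i)). Qed.

Lemma nth_step_k0 k i : (i <= m)%N ->
  (step_k0 k)`_i = if (i == 0)%N then k`_0 + k`_1
                   else if (i < m)%N then k`_i.+1 else k`_0.
Proof.
exact: (@nth_mktuple_nat (fun i => if (i == 0)%N then k`_0 + k`_1
                   else if (i < m)%N then k`_i.+1 else k`_0)).
Qed.

Lemma nth_step_k1 k i : (i <= m)%N ->
  (step_k1 k)`_i = if (i < m)%N then k`_i else k`_0 + k`_m.
Proof. exact: (@nth_mktuple_nat (fun i => if (i < m)%N then k`_i else k`_0 + k`_m)). Qed.

Lemma nth_dual w a i : (i <= m)%N ->
  (dual w a)`_i = if (i == 0)%N then a`_0 + a`_m else if w then a`_i.-1 else a`_i.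
Proof.
exact: (@nth_mktuple_nat (fun i => if (i == 0)%N then a`_0 + a`_m
                          else if w then a`_i.-1 else a`_i)).
Qed.

Lemma nth_back0 k i : (i <= m)%N ->
  (back true k)`_i = if (i == 0)%N then k`_m
           else if (i == 1)%N then k`_0 - k`_m else k`_i.-1.
Proof.
exact: (@nth_mktuple_nat (fun i => if (i == 0)%N then k`_m
           else if (i == 1)%N then k`_0 - k`_m else k`_i.-1)).
Qed.

Lemma nth_back1 k i : (i <= m)%N ->
  (back false k)`_i = if (i < m)%N then k`_i else k`_m - k`_0.
Proof. exact: (@nth_mktuple_nat (fun i => if (i < m)%N then k`_i else k`_m - k`_0)). Qed.

End steps.
(* Simplification would otherwise unfold these tuples under the projection to
   sequences, where the lemmas [nth_...] no longer apply. *)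
#[global] Opaque back dual step_l0 step_l1 step_k0 step_k1.

Section dot_product.
Context {R : realType} {m : nat}.
Local Notation vec := (m.+1.-tuple R).
Implicit Types (l k a b : vec) (w : bool).

Definition dot b k : R := \sum_(i < m.+1) b`_i * k`_i.

Lemma dot_nat b k : dot b k = \sum_(0 <= i < m.+1) b`_i * k`_i.
Proof. by rewrite big_mkord. Qed.

Hypothesis m0 : (0 < m)%N.

Lemma step_kK w k : back w (step_k w k) = k.
Proof.
apply: eq_vec => i im; case: w => /=.
  rewrite nth_back0//; case: i im => [|[|i]] im /=; rewrite !nth_step_k0//=.
  - by rewrite ltnn gtn_eqF.
  - by rewrite ltnn gtn_eqF//; ring.
  - by rewrite im.
  - by rewrite ltnW.
rewrite nth_back1//; case: ltnP => mi; rewrite !nth_step_k1//.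
  by rewrite mi.
by rewrite ltnn m0 (_ : i = m); [ring|apply/eqP; rewrite eqn_leq im].
Qed.

Lemma backK w k : step_k w (back w k) = k.
Proof.
apply: eq_vec => i im; case: w => /=.
  rewrite nth_step_k0//; case: i im => [|i] im /=.
    by rewrite !nth_back0//=; ring.
  case: ltnP => mi; first by rewrite nth_back0.
  by rewrite nth_back0//= (_ : i.+1 = m)//; apply/eqP; rewrite eqn_leq im.
rewrite nth_step_k1//; case: ltnP => mi; rewrite !nth_back1//.
  by rewrite mi.
by rewrite ltnn m0 (_ : i = m); [ring|apply/eqP; rewrite eqn_leq im].
Qed.

Lemma step_lK w l : dual w (step_l w l) = l.
Proof.
apply: eq_vec => i im; case: w => /=.
  rewrite nth_dual//; case: i im => [|i] im /=.
    by rewrite !nth_step_l0//= ltnn m0; ring.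
  by rewrite nth_step_l0 ?im// ltnW.
rewrite nth_dual//; case: i im => [|i] im /=.
  by rewrite !nth_step_l1//= gtn_eqF//; ring.
by rewrite nth_step_l1.
Qed.

Lemma dualK w l : step_l w (dual w l) = l.
Proof.
apply: eq_vec => i im; case: w => /=.
  rewrite nth_step_l0//; case: ltnP => mi; rewrite !nth_dual//=.
  by rewrite (_ : i = m); [ring|apply/eqP; rewrite eqn_leq im].
rewrite nth_step_l1//; case: i im => [|i] im /=; rewrite !nth_dual//=.
by rewrite gtn_eqF//; ring.
Qed.

Lemma sum_ends (F : nat -> R) :
  \sum_(0 <= i < m.+1) F i = F 0%N + \sum_(0 <= i < m.-1) F i.+1 + F m.
Proof. by case: m m0 => [//|n] _; rewrite big_nat_recr//= big_nat_recl. Qed.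

Lemma sum_front (F : nat -> R) :
  \sum_(0 <= i < m.+1) F i = F 0%N + F 1%N + \sum_(0 <= i < m.-1) F i.+2.
Proof. by case: m m0 => [//|n] _; rewrite big_nat_recl//= big_nat_recl//= addrA. Qed.

(** The two components of the extended map are contragredient: this is what
    preserves the equation of the level set of [N]. *)
Lemma dot_dual w b k : dot (dual w b) (back w k) = dot b k.
Proof.
rewrite !dot_nat; case: w.
  rewrite sum_front sum_ends (@eq_big_nat _ _ _ _ _ _ (fun i => b`_i.+1 * k`_i.+1)); last first.
    by move=> i /andP[_ im]; rewrite nth_dual ?nth_back0//=; lia.
  by rewrite !nth_dual ?nth_back0//=; ring.
rewrite sum_ends [in RHS]sum_ends.
rewrite (@eq_big_nat _ _ _ _ _ _ (fun i => b`_i.+1 * k`_i.+1)); last first.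
  by move=> i /andP[_ im]; rewrite nth_dual ?nth_back1//= ?ifT//; lia.
by rewrite !nth_dual ?nth_back1//= ltnn m0 gtn_eqF//; ring.
Qed.

Lemma dot_step w l k : dot (step_l w l) (step_k w k) = dot l k.
Proof. by rewrite -(dot_dual w) step_lK step_kK. Qed.

Lemma measurable_step_l w : measurable_fun setT (@step_l R m w).
Proof. by case: w; [exact: measurable_step_l0|exact: measurable_step_l1]. Qed.

Lemma measurable_step_k w : measurable_fun setT (@step_k R m w).
Proof. by case: w; [exact: measurable_step_k0|exact: measurable_step_k1]. Qed.

Lemma measurable_nth_neg n i : measurable_fun setT (fun t : n.-tuple R => - t`_i).
Proof. by apply: measurableT_comp => //; exact: measurable_nth. Qed.

Lemma nth_rot (s : vec) i : (i <= m)%N ->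
  (rot_tuple s)`_i = if (i < m)%N then s`_i.+1 else s`_0.
Proof.
move=> im; rewrite /rot_tuple /= nth_rcons size_tuple nth_behead.
case: ltnP => // mi; rewrite (_ : i = m) ?eqxx ?/thead ?(tnth_nth 0)//.
by apply/eqP; rewrite eqn_leq im.
Qed.

Lemma nth_shear phi (s : vec) i : (i <= m)%N ->
  (shear phi s)`_i = if (i == 0)%N then s`_0 + phi [tuple of behead s] else s`_i.
Proof. by case: i => [|i] im /=; rewrite ?nth_behead// /thead (tnth_nth 0). Qed.

Lemma step_l0E : @step_l0 R m = rot_tuple \o shear (fun t : m.-tuple R => - t`_0).
Proof.
apply/funext => s; apply: eq_vec => i im; rewrite nth_step_l0// nth_rot//.
by case: ltnP => mi; rewrite nth_shear//= nth_behead.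
Qed.

Lemma step_l1E : @step_l1 R m = shear (fun t : m.-tuple R => - t`_m.-1).
Proof.
apply/funext => s; apply: eq_vec => i im; rewrite nth_step_l1// nth_shear//=.
by rewrite nth_behead prednK.
Qed.

Lemma step_k0E : @step_k0 R m = shear (fun t : m.-tuple R => t`_m.-1) \o rot_tuple.
Proof.
apply/funext => s; apply: eq_vec => i im.
rewrite nth_step_k0// nth_shear//= nth_behead prednK// !nth_rot//.
by rewrite m0 ltnn addrC.
Qed.

Lemma step_k1E : @step_k1 R m \o rot_tuple = rot_tuple \o shear (fun t : m.-tuple R => t`_0).
Proof.
apply/funext => s; apply: eq_vec => i im.
rewrite nth_step_k1// !nth_rot// m0 ltnn.
by case: ltnP => mi; rewrite nth_shear//= nth_behead addrC.
Qed.

(** The maps of both branches are unimodular. *)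
Lemma lebn_step_l w (A : set vec) : measurable A ->
  lebn m.+1 (step_l w @^-1` A) = lebn m.+1 A.
Proof.
move=> mA; case: w.
  rewrite (step_l0E : step_l true = _) comp_preimage lebn_shear; first exact: lebn_rot.
    exact: measurable_nth_neg.
  exact: measurable_preimage (@measurable_rot_tuple _ _) mA.
by rewrite (step_l1E : step_l false = _); apply: lebn_shear => //; exact: measurable_nth_neg.
Qed.

Lemma lebn_step_k w (A : set vec) : measurable A ->
  lebn m.+1 (step_k w @^-1` A) = lebn m.+1 A.
Proof.
move=> mA; case: w.
  rewrite (step_k0E : step_k true = _) comp_preimage lebn_rot; last first.
    by apply: measurable_preimage => //; apply: measurable_shear; exact: measurable_nth.
  by apply: lebn_shear => //; exact: measurable_nth.
rewrite -lebn_rot; last by apply: measurable_preimage => //; exact: measurable_step_k1.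
rewrite -comp_preimage (step_k1E : step_k false \o _ = _) comp_preimage.
rewrite lebn_shear; first exact: lebn_rot.
  exact: measurable_nth.
exact: measurable_preimage (@measurable_rot_tuple _ _) mA.
Qed.

Lemma measurable_back w : measurable_fun setT (@back R m w).
Proof.
case: w.
  apply: (@measurable_mktuple _ _ (fun i k => if i == 0 :> nat then k`_m
           else if i == 1 :> nat then k`_0 - k`_m else k`_i.-1)) => i.
  case: (_ == _); first exact: measurable_nth.
  by case: (_ == _); [exact: measurable_nthB|exact: measurable_nth].
apply: (@measurable_mktuple _ _ (fun i k => if (i < m)%N then k`_i else k`_m - k`_0)) => i.
by case: (_ < _)%N; [exact: measurable_nth|exact: measurable_nthB].
Qed.

Lemma lebn_back w (A : set vec) : measurable A ->
  lebn m.+1 (back w @^-1` A) = lebn m.+1 A.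
Proof.
move=> mA; rewrite -(lebn_step_k w); last exact: measurable_preimage (measurable_back w) mA.
rewrite -comp_preimage (_ : _ \o _ = id)//.
by apply/funext => k; exact: step_kK.
Qed.

End dot_product.

(** * The energy of a past *)
Section energy.
Context {R : realType} {m : nat}.
Local Notation vec := (m.+1.-tuple R).
Implicit Types (l k a b : vec) (w : bool) (s : vec * vec * vec).

(** The slopes [b_i / a_i] are the values of a linear form at the vertices of
    the current simplex, normalised by [a].  The gap is their difference at the
    two vertices whose mean enters in the next step. *)
Definition gap a b := b`_0 / a`_0 - b`_m / a`_m.

(** The branch [true] drops the vertex [m], and its relative measure is
    [a_m / (a_0 + a_m)]; the branch [false] drops the vertex [0].  The gain of a
    branch is the probability of the other branch times half the squared gap.
    Its mean is then the conditional variance of the slope that is replaced. *)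
Definition gain w a b :=
  (if w then a`_0 else a`_m) / (a`_0 + a`_m) * gap a b ^+ 2 / 2.

(** The branch by which [k] was reached, see [branch_step]. *)
Definition branch k : bool := k`_m < k`_0.

(** One step into the past of a state [(a, b, k)]: the vector [k] chooses the
    branch, and the row vectors [a] and [b] are multiplied by its matrix. *)
Definition pull s : vec * vec * vec :=
  let w := branch s.2 in (dual w s.1.1, dual w s.1.2, back w s.2).

Definition gain_of s := gain (branch s.2) s.1.1 s.1.2.

Definition energy n s : R := \sum_(i < n) gain_of (iter i pull s).

Lemma energyS n s : energy n.+1 s = gain_of s + energy n (pull s).
Proof.
by rewrite /energy big_ord_recl; congr (_ + _); apply: eq_bigr => i _; rewrite -iterSr.
Qed.

Definition spread a b := \sum_(i < m.+1) (b`_i / a`_i) ^+ 2.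
(** Up to the factor [(m + 1)!], this is the volume of the simplex of the
    positive [k] with [dot a k < N].  It is the volume of the smallest box that
    contains this simplex. *)
Definition weight (N : R) a := \prod_(i < m.+1) (N / a`_i).

Definition positive (k : vec) := forall i, (i <= m)%N -> 0 < k`_i.

Definition excess (N : R) n a b (M : R) : set vec :=
  [set k | [/\ positive k, dot a k < N & M <= energy n (a, b, k)]].

Hypothesis m0 : (0 < m)%N.

Lemma measurable_branch d (T : measurableType d) (f : T -> vec) : measurable_fun setT f ->
  measurable_fun setT (fun x => branch (f x)).
Proof.
by move=> mf; apply: measurable_fun_ltr; apply: (measurableT_comp (measurable_nth _)).
Qed.

Lemma measurable_dual w : measurable_fun setT (@dual R m w).
Proof.
apply: (@measurable_mktuple _ _ (fun i a => if i == 0 :> nat then a`_0 + a`_m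
  else if w then a`_i.-1 else a`_i)) => i.
case: (_ == _); first exact: measurable_nthD.
by case: w; exact: measurable_nth.
Qed.

Lemma measurable_pull : measurable_fun setT pull.
Proof.
have mb : measurable_fun setT (fun s : vec * vec * vec => branch s.2).
  by apply: measurable_branch.
have mw (w : vec * vec * vec -> bool) (f : bool -> vec -> vec) (g : vec * vec * vec -> vec) :
    measurable_fun setT w -> measurable_fun setT (f true) ->
    measurable_fun setT (f false) -> measurable_fun setT g ->
    measurable_fun setT (fun s => f (w s) (g s)).
  move=> hw ht hf hg.
  rewrite (_ : (fun _ => _) = (fun s => if w s then f true (g s) else f false (g s))).
    by apply: measurable_fun_ifT => //;
      [apply: (measurableT_comp ht)|apply: (measurableT_comp hf)].
  by apply/funext => s; case: (w s).
apply: measurable_fun_pair; first apply: measurable_fun_pair.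
- apply: (mw _ _ (fun s => s.1.1)) => //; try exact: measurable_dual.
  exact: measurableT_comp.
- apply: (mw _ _ (fun s => s.1.2)) => //; try exact: measurable_dual.
  exact: measurableT_comp.
- by apply: (mw _ _ snd) => //; exact: measurable_back.
Qed.

Lemma measurable_gain w : measurable_fun setT (fun z : vec * vec => gain w z.1 z.2).
Proof.
have m1 i : measurable_fun setT (fun z : vec * vec => z.1`_i).
  by apply: (measurableT_comp (measurable_nth _)).
have m2 i : measurable_fun setT (fun z : vec * vec => z.2`_i).
  by apply: (measurableT_comp (measurable_nth _)).
have mV (f : vec * vec -> R) : measurable_fun setT f ->
    measurable_fun setT (fun z => (f z)^-1).
  by move=> mf; apply: (measurableT_comp measurable_invr).
apply: measurable_funM; last exact: measurable_cst.
apply: measurable_funM.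
  apply: measurable_funM; last by apply: mV; exact: measurable_funD.
  by case: w.
apply: measurable_funX; apply: measurable_funB; apply: measurable_funM => //; exact: mV.
Qed.

Lemma measurable_gain_of : measurable_fun setT gain_of.
Proof.
rewrite (_ : gain_of = (fun s =>
    if branch s.2 then gain true s.1.1 s.1.2 else gain false s.1.1 s.1.2)).
  apply: measurable_fun_ifT; first exact: measurable_branch.
    exact: (measurableT_comp (measurable_gain true) measurable_fst).
  exact: (measurableT_comp (measurable_gain false) measurable_fst).
by apply/funext => s; rewrite /gain_of; case: branch.
Qed.

Lemma measurable_energy n : measurable_fun setT (energy n).
Proof.
apply: measurable_sum => i; apply: (measurableT_comp measurable_gain_of).
by apply: measurable_iter; exact: measurable_pull.
Qed.

Lemma measurable_positive : measurable [set k : vec | positive k].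
Proof.
rewrite (_ : [set _ | _] =
  \bigcap_(i in [set i | (i <= m)%N]) [set k : vec | 0 < k`_i])//.
by apply: bigcap_measurableType => i _; apply: measurable_lt => //; exact: measurable_nth.
Qed.

Lemma measurable_dot d (T : measurableType d) (f g : T -> vec) : measurable_fun setT f ->
  measurable_fun setT g -> measurable_fun setT (fun x => dot (f x) (g x)).
Proof.
move=> mf mg; apply: measurable_sum => i.
by apply: measurable_funM; apply: (measurableT_comp (measurable_nth _)).
Qed.

Lemma measurable_le d (T : measurableType d) (f g : T -> R) :
  measurable_fun setT f -> measurable_fun setT g ->
  measurable [set x | f x <= g x].
Proof.
move=> mf mg; rewrite (_ : [set _ | _] = ~` [set x | g x < f x]).
  by apply: measurableC; exact: measurable_lt.
by apply/seteqP; split => x /=; rewrite leNgt => /negP.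
Qed.

Lemma measurable_excess N n a b M : measurable (excess N n a b M).
Proof.
rewrite (_ : excess _ _ _ _ _ = [set k | positive k] `&` ([set k | dot a k < N] `&`
   [set k | M <= energy n (a, b, k)])); last first.
  by apply/seteqP; split => k; [case=> ? ? ?; split|case=> ? [? ?]; split].
apply: measurableI; first exact: measurable_positive.
apply: measurableI; first by apply: measurable_lt => //; exact: measurable_dot.
apply: measurable_le => //.
by apply: (measurableT_comp (measurable_energy n)).
Qed.

(** The vectors without a past. *)
Lemma lebn_tie : lebn m.+1 [set k : vec | k`_0 = k`_m] = 0%E.
Proof.
rewrite lebnSr; last by apply: measurable_eq_fun; exact: measurable_nth.
rewrite integral0_eq// => t _.
rewrite (_ : [set _ | _] = [set t`_m.-1]); first exact: lebesgue_measure_set1.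
by apply/seteqP; split => x /=; case: m m0 t.
Qed.

Lemma gain_ge0 w a b : positive a -> 0 <= gain w a b.
Proof.
move=> a0; have := a0 0%N (leq0n _); have := a0 m (leqnn _) => am ao.
have h : 0 <= a`_0 + a`_m by rewrite addr_ge0// ltW.
rewrite /gain divr_ge0// mulr_ge0 ?sqr_ge0// divr_ge0//.
by case: w; exact: ltW.
Qed.

Lemma positive_dual w a : positive a -> positive (dual w a).
Proof.
move=> a0 i im; rewrite nth_dual//; case: eqP => [_|i0].
  by rewrite addr_gt0// a0.
by case: w; apply: a0 => //; lia.
Qed.

Lemma weight_ge0 N a : 0 < N -> positive a -> 0 <= weight N a.
Proof.
move=> N0 a0; apply: prodr_ge0 => i _; rewrite divr_ge0// ltW// a0//.
by rewrite -ltnS.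
Qed.

Lemma spread_ge0 a b : 0 <= spread a b.
Proof. by apply: sumr_ge0 => i _; exact: sqr_ge0. Qed.

Lemma sum_last (F : nat -> R) : \sum_(i < m.+1) F i = \sum_(i < m) F i + F m.
Proof. by rewrite big_ord_recr. Qed.
Lemma sum_first (F : nat -> R) : \sum_(i < m.+1) F i = F 0%N + \sum_(i < m) F i.+1.
Proof. by rewrite big_ord_recl. Qed.
Lemma prod_last (F : nat -> R) : \prod_(i < m.+1) F i = \prod_(i < m) F i * F m.
Proof. by rewrite big_ord_recr. Qed.
Lemma prod_first (F : nat -> R) : \prod_(i < m.+1) F i = F 0%N * \prod_(i < m) F i.+1.
Proof. by rewrite big_ord_recl. Qed.

(** The two branches cut the simplex in the proportion [a_m : a_0]. *)
Lemma weight_dual N a w : positive a ->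
  weight N (dual w a) = weight N a * (if w then a`_m else a`_0) / (a`_0 + a`_m).
Proof.
move=> a0; have := a0 0%N (leq0n _); have := a0 m (leqnn _) => am ao.
have am' : a`_0 + a`_m != 0 by rewrite gt_eqF// addr_gt0.
rewrite /weight (prod_first (fun i => N / (dual w a)`_i)) nth_dual//=; case: w.
  have -> : \prod_(i < m) (N / (dual true a)`_i.+1) = \prod_(i < m) (N / a`_i).
    by apply: eq_bigr => i _; rewrite nth_dual.
  rewrite (prod_last (fun i => N / a`_i)).
  by field; rewrite am' gt_eqF.
have -> : \prod_(i < m) (N / (dual false a)`_i.+1) = \prod_(i < m) (N / a`_i.+1).
  by apply: eq_bigr => i _; rewrite nth_dual.
rewrite (prod_first (fun i => N / a`_i)).
by field; rewrite am' gt_eqF.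
Qed.

Lemma spread_dual a b w :
  spread (dual w a) (dual w b) = spread a b
   - (if w then b`_m / a`_m else b`_0 / a`_0) ^+ 2
   + ((b`_0 + b`_m) / (a`_0 + a`_m)) ^+ 2.
Proof.
rewrite /spread (sum_first (fun i => ((dual w b)`_i / (dual w a)`_i) ^+ 2)).
rewrite !nth_dual//=; case: w.
  have -> : \sum_(i < m) ((dual true b)`_i.+1 / (dual true a)`_i.+1) ^+ 2 =
      \sum_(i < m) (b`_i / a`_i) ^+ 2.
    by apply: eq_bigr => i _; rewrite !nth_dual.
  by rewrite (sum_last (fun i => (b`_i / a`_i) ^+ 2)); ring.
have -> : \sum_(i < m) ((dual false b)`_i.+1 / (dual false a)`_i.+1) ^+ 2 =
    \sum_(i < m) (b`_i.+1 / a`_i.+1) ^+ 2.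
  by apply: eq_bigr => i _; rewrite !nth_dual.
by rewrite (sum_first (fun i => (b`_i / a`_i) ^+ 2)); ring.
Qed.

(** The spread loses in the mean what the gain adds.  The slopes [0] and [m] have
    a mean with the weights [a_0] and [a_m], and this mean replaces each of them
    with the probability given by its weight; so the expected square drops by
    the variance. *)
Lemma expected_spread N a b : positive a ->
  weight N (dual true a) * (spread (dual true a) (dual true b) + gain true a b)
  + weight N (dual false a) * (spread (dual false a) (dual false b) + gain false a b)
  = weight N a * spread a b.
Proof.
move=> a0; have := a0 0%N (leq0n _); have := a0 m (leqnn _) => am ao.
have am' : a`_0 + a`_m != 0 by rewrite gt_eqF// addr_gt0.
rewrite !weight_dual// !spread_dual// /gain /gap.
move: (weight N a) (spread a b) => W P.
by field; rewrite am' !gt_eqF.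
Qed.


Lemma excess_le_weight N n a b M : 0 < N -> positive a ->
  (lebn m.+1 (excess N n a b M) <= (weight N a)%:E)%E.
Proof.
move=> N0 a0; pose c : vec := [tuple N / a`_i | i < m.+1].
have cE i : tnth c i = N / a`_i by rewrite tnth_mktuple.
have c0 i : 0 < tnth c i by rewrite cE divr_gt0// a0// -ltnS.
have -> : weight N a = \prod_(i < m.+1) tnth c i.
  by apply: eq_bigr => i _; rewrite cE.
rewrite -lebn_box//; apply: le_measure; rewrite ?inE.
- exact: measurable_excess.
- exact: measurable_box.
move=> k [k0 kN _] i.
have im : (i <= m)%N by rewrite -ltnS.
have ai := a0 _ im.
rewrite cE (tnth_nth 0) k0//= ltr_pdivlMr// mulrC (le_lt_trans _ kN)//.
rewrite /dot (bigD1 i)//= lerDl sumr_ge0// => j _.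
by rewrite mulr_ge0// ltW// ?a0 ?k0// -ltnS.
Qed.

(** A vector of the simplex of [a] either has equal outer entries or is the
    image of a vector of the simplex of [dual w a], with [w] its branch. *)
Lemma excessS N n a b M : excess N n.+1 a b M `<=`
  (back true @^-1` excess N n (dual true a) (dual true b) (M - gain true a b)
   `|` back false @^-1` excess N n (dual false a) (dual false b) (M - gain false a b))
  `|` [set k | k`_0 = k`_m].
Proof.
move=> k [k0 kN Mk].
have [kk|kk] := eqVneq k`_0 k`_m; first by right.
left; rewrite energyS /pull /gain_of /= in Mk.
have dk w : dot (dual w a) (back w k) < N by rewrite dot_dual.
have Mk' : M - gain (branch k) a b <=
    energy n (dual (branch k) a, dual (branch k) b, back (branch k) k).
  by rewrite lerBlDl.
move: Mk'; rewrite /branch; case: ltP => [kk' Mk'|kk' Mk']; [left|right]; split => //.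
  move=> i im; rewrite nth_back0//; case: eqP => _; first exact: k0.
  by case: eqP => _; [rewrite subr_gt0|apply: k0; lia].
move=> i im; rewrite nth_back1//; case: ltnP => _; first exact: k0.
by rewrite subr_gt0 lt_neqAle kk.
Qed.

(** The induction step of the maximal inequality.  A set of measure [x] inside
    a simplex of weight [W] and spread [P] must still collect the energy
    [M - g].  The bound [W * P / (M - g)] can exceed [W * (P + g) / M] only when
    [P > M - g], and then the trivial bound [W] is good enough. *)
Lemma markov_step (W P g M x : R) : 0 <= W -> 0 <= P -> 0 <= g -> 0 < M ->
  x <= W -> (0 < M - g -> x <= W * P / (M - g)) -> x <= W * (P + g) / M.
Proof.
move=> W0 P0 g0 M0 xW xP; have [Mg|Mg] := ltP 0 (M - g); last first.
  by rewrite (le_trans xW)// ler_pdivlMr// ler_wpM2l//; lra.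
have [PM|PM] := leP P (M - g).
  rewrite (le_trans (xP Mg))// -!mulrA ler_wpM2l// ler_pdivrMr// -mulrAC.
  by rewrite ler_pdivlMr//; nra.
by rewrite (le_trans xW)// ler_pdivlMr// ler_wpM2l//; lra.
Qed.

(** Markov's inequality for the total energy.  It is proved by induction on the
    number of steps, with the volumes themselves in place of a probability
    measure: the backward maps preserve volume and [expected_spread] adds up
    the bounds for the two branches. *)
Lemma excess_le N n a b M : 0 < N -> positive a -> 0 < M ->
  (lebn m.+1 (excess N n a b M) <= (weight N a * spread a b / M)%:E)%E.
Proof.
move=> N0; elim: n a b M => [|n IH] a b M a0 M0.
  rewrite (_ : excess _ _ _ _ _ = set0).
    by rewrite measure0 lee_fin divr_ge0 ?mulr_ge0 ?weight_ge0 ?spread_ge0// ltW.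
  by apply/seteqP; split => k // [_ _]; rewrite /energy big_ord0 leNgt M0.
pose E w := excess N n (dual w a) (dual w b) (M - gain w a b).
have mE w : measurable (E w) by exact: measurable_excess.
have fE w : lebn m.+1 (E w) \is a fin_num.
  rewrite ge0_fin_numE//.
  by rewrite (le_lt_trans (excess_le_weight _ _ _ N0 (positive_dual w a0)))// ltry.
have bound w : (lebn m.+1 (E w) <=
    (weight N (dual w a) * (spread (dual w a) (dual w b) + gain w a b) / M)%:E)%E.
  rewrite -(fineK (fE w)) lee_fin; apply: markov_step => //.
  - by rewrite weight_ge0//; exact: positive_dual.
  - exact: spread_ge0.
  - exact: gain_ge0.
  - by rewrite -lee_fin fineK//; apply: excess_le_weight => //; exact: positive_dual.
  - by move=> Mg; rewrite -lee_fin fineK//; apply: IH => //; exact: positive_dual.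
have mb w : measurable (back w @^-1` E w).
  by apply: measurable_preimage => //; exact: measurable_back.
have mt : measurable [set k : vec | k`_0 = k`_m].
  by apply: measurable_eq_fun; exact: measurable_nth.
have bound' w : (lebn m.+1 (back w @^-1` E w) <=
    (weight N (dual w a) * (spread (dual w a) (dual w b) + gain w a b) / M)%:E)%E.
  by rewrite lebn_back.
apply: (le_trans (le_measure _ _ _ (@excessS N n a b M))); rewrite ?inE.
- exact: measurable_excess.
- by apply: measurableU => //; exact: measurableU.
apply: (le_trans (measureU2 _ _ _)) => //; first exact: measurableU.
rewrite [X in (_ + X <= _)%E]lebn_tie adde0; apply: (le_trans (measureU2 _ _ _)) => //.
apply: (le_trans (leeD (bound' true) (bound' false))).
by rewrite -EFinD -mulrDl expected_spread.
Qed.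

Lemma positive_iter_pull n s : positive s.1.1 -> positive (iter n pull s).1.1.
Proof. by move=> s0; elim: n => [//|n IH] /=; exact: positive_dual. Qed.

Lemma energy_nd a b k : positive a ->
  {homo energy^~ (a, b, k) : n p / (n <= p)%N >-> n <= p}.
Proof.
move=> a0; apply: homo_leq => [//|? ? ?|n]; first exact: le_trans.
rewrite /energy big_ord_recr/= lerDl; apply: gain_ge0.
exact: (@positive_iter_pull n (a, b, k)).
Qed.

Definition unbounded_energy N a b : set vec :=
  [set k | [/\ positive k, dot a k < N & forall M, exists n, M <= energy n (a, b, k)]].

Lemma unbounded_energyE N a b : unbounded_energy N a b =
  \bigcap_(M : nat) \bigcup_n excess N n a b M%:R.
Proof.
apply/seteqP; split => k.
  by move=> [k0 kN H] M _; have [n Mn] := H M%:R; exists n.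
move=> H; have [_ _ [k0 kN _]] := H 0%N I; split => // M.
have [n _ [_ _ Mn]] := H (Num.bound `|M|) I; exists n; rewrite (le_trans _ Mn)//.
exact: (le_trans (ler_norm M) (ltW (archi_boundP (normr_ge0 M)))).
Qed.

Lemma measurable_unbounded_energy N a b : measurable (unbounded_energy N a b).
Proof.
rewrite unbounded_energyE; apply: bigcapT_measurable => M.
by apply: bigcupT_measurable => n; exact: measurable_excess.
Qed.

Lemma lebn_unbounded_energy N a b : 0 < N -> positive a ->
  lebn m.+1 (unbounded_energy N a b) = 0%E.
Proof.
move=> N0 a0; apply/eqP; rewrite eq_le measure_ge0 andbT.
have H (M : nat) : (lebn m.+1 (unbounded_energy N a b) <=
    (weight N a * spread a b / M.+1%:R)%:E)%E.
  have cv : (lebn m.+1 (excess N n a b M.+1%:R) @[n --> \oo] -->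
      lebn m.+1 (\bigcup_n excess N n a b M.+1%:R))%E.
    apply: nondecreasing_cvg_mu.
    - by move=> n; exact: measurable_excess.
    - by apply: bigcupT_measurable => n; exact: measurable_excess.
    - move=> n p np; apply/subsetPset => k [k0 kN Mk]; split => //.
      by rewrite (le_trans Mk)// energy_nd.
  apply: (@le_trans _ _ (lebn m.+1 (\bigcup_n excess N n a b M.+1%:R))).
    apply: le_measure; rewrite ?inE.
    - exact: measurable_unbounded_energy.
    - by apply: bigcupT_measurable => n; exact: measurable_excess.
    - by rewrite unbounded_energyE => k /(_ M.+1 I).
  rewrite -(cvg_lim _ cv)//; apply: lime_le; first by apply/cvg_ex; eexists; exact: cv.
  by near=> n; exact: excess_le.
apply/lee_addgt0Pr => e e0; rewrite add0e.
pose M := Num.bound (e^-1 * (weight N a * spread a b)).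
apply: (le_trans (H M)); rewrite lee_fin ler_pdivrMr// -ler_pdivrMl//.
rewrite (le_trans (ltW (archi_boundP _)))// ?ler_nat ?leqnSn//.
by rewrite !mulr_ge0 ?weight_ge0 ?spread_ge0// invr_ge0 ltW.
Unshelve. all: by end_near. Qed.

End energy.

(** * Finite energy makes the slopes merge *)
Section contraction.
Context {R : realType} {m : nat}.
Local Notation vec := (m.+1.-tuple R).
Implicit Types (l k a b : vec) (w : bool) (s : vec * vec * vec).
Hypothesis m0 : (0 < m)%N.

Definition slope a b i := b`_i / a`_i.

(** A point of the triangle has its largest entry in front; this much of the
    order survives under [dual]. *)
Definition headmax a := forall i, (i <= m)%N -> a`_i <= a`_0.

Lemma headmax_dual w a : positive a -> headmax a -> headmax (dual w a).
Proof.
move=> a0 am i im; rewrite !nth_dual//=; case: eqP => [//|i0].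
have := a0 m (leqnn _) => am0.
have Hi j : (j <= m)%N -> a`_j <= a`_0 + a`_m.
  by move=> jm; rewrite (le_trans (am _ jm))// lerDl ltW.
by case: w; apply: Hi; lia.
Qed.

Lemma slope_dual w a b i : (0 < i <= m)%N ->
  slope (dual w a) (dual w b) i = slope a b (if w then i.-1 else i).
Proof.
move=> /andP[i0 im]; rewrite /slope !nth_dual// gtn_eqF//.
by case: w.
Qed.

Lemma gap_slope a b : gap a b = slope a b 0 - slope a b m.
Proof. by []. Qed.

Lemma slope_dual0 w a b : positive a -> slope (dual w a) (dual w b) 0 =
  slope a b m + a`_0 / (a`_0 + a`_m) * gap a b.
Proof.
move=> a0; have := a0 0%N (leq0n _); have := a0 m (leqnn _) => am ao.
have am' : a`_0 + a`_m != 0 by rewrite gt_eqF// addr_gt0.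
by rewrite /slope /gap !nth_dual//=; field; rewrite am' !gt_eqF.
Qed.

(** As [a_0 >= a_m], dropping the vertex [m] is the less likely choice, so its
    gain is comparable with the full squared gap. *)
Lemma gap_sqr_true a b : positive a -> headmax a -> gap a b ^+ 2 <= 4 * gain true a b.
Proof.
move=> a0 h; have := a0 0%N (leq0n _); have := a0 m (leqnn _) => am ao.
have := h m (leqnn _) => ham.
have s0 : 0 < a`_0 + a`_m by rewrite addr_gt0.
rewrite /gain; have : 1 <= 2 * (a`_0 / (a`_0 + a`_m)).
  by rewrite mulrA ler_pdivlMr//; lra.
move: (a`_0 / _) (sqr_ge0 (gap a b)) => p; nra.
Qed.

(** Dropping the vertex [0] multiplies the gap by [1 - p], with
    [p = a_m / (a_0 + a_m)], and [1 - (1 - p) ^ 2] is at most [2 * p]: the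
    decrease of the squared gap is paid for by the gain. *)
Lemma gap_sqr_false a b : positive a -> headmax a ->
  gap a b ^+ 2 <= gap (dual false a) (dual false b) ^+ 2 + 4 * gain false a b.
Proof.
move=> a0 h; have := a0 0%N (leq0n _); have := a0 m (leqnn _) => am ao.
have := h m (leqnn _) => ham.
have s0 : 0 < a`_0 + a`_m by rewrite addr_gt0.
rewrite (gap_slope (dual _ _)) slope_dual0// slope_dual ?m0 ?leqnn//.
rewrite addrAC subrr add0r /gain.
have -> : a`_0 / (a`_0 + a`_m) = 1 - a`_m / (a`_0 + a`_m).
  by field; rewrite gt_eqF.
have : 0 <= a`_m / (a`_0 + a`_m) by rewrite divr_ge0// ltW.
move: (a`_m / _) (sqr_ge0 (gap a b)) => p; rewrite exprMn.
move: (gap a b ^+ 2) => G; nra.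
Qed.

Lemma slope_dual0_near w a b : positive a ->
  `|slope (dual w a) (dual w b) 0 - slope a b 0| <= `|gap a b|.
Proof.
move=> a0; have := a0 0%N (leq0n _); have := a0 m (leqnn _) => am ao.
have s0 : 0 < a`_0 + a`_m by rewrite addr_gt0.
rewrite slope_dual0//.
have -> : slope a b m + a`_0 / (a`_0 + a`_m) * gap a b - slope a b 0 =
   - (a`_m / (a`_0 + a`_m)) * gap a b.
  by rewrite gap_slope; field; rewrite gt_eqF.
have p0 : 0 <= a`_m / (a`_0 + a`_m) by rewrite divr_ge0// ltW.
rewrite normrM normrN [X in X * _]ger0_norm//.
by rewrite ler_piMl// ler_pdivrMr// mul1r lerDr ltW.
Qed.

Variable s0 : vec * vec * vec.
Let s n := iter n pull s0.
Let a n := (s n).1.1.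
Let b n := (s n).1.2.
Let k n := (s n).2.
Let w n := branch (k n).
Let u n i := slope (a n) (b n) i.
Let g n := gap (a n) (b n).

Hypothesis pos_a0 : positive (a 0).
Hypothesis max_a0 : headmax (a 0).
Hypothesis pos_k : forall n, positive (k n).
Hypothesis bounded : exists M, forall n, energy n s0 < M.

Let aS n : a n.+1 = dual (w n) (a n). Proof. by []. Qed.
Let bS n : b n.+1 = dual (w n) (b n). Proof. by []. Qed.
Let kS n : k n.+1 = back (w n) (k n). Proof. by []. Qed.

Let pos_a n : positive (a n).
Proof. by elim: n => [//|n IH]; rewrite aS; exact: positive_dual. Qed.

Let max_a n : headmax (a n).
Proof. by elim: n => [//|n IH]; rewrite aS; exact: headmax_dual. Qed.

(** As long as the branch is [false], [k_m] decreases by the constant [k_0]. *)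
Let recurrent n : exists2 p, (n <= p)%N & w p.
Proof.
apply: contrapT => H.
have nw p : (n <= p)%N -> w p = false.
  by move=> np; apply/negP => wp; apply: H; exists p.
have E p : (k (n + p))`_0 = (k n)`_0 /\ (k (n + p))`_m = (k n)`_m - (k n)`_0 *+ p.
  elim: p => [|p [E0 Em]]; first by rewrite addn0 mulr0n subr0.
  rewrite addnS kS nw ?leq_addr// !nth_back1// m0 ltnn E0 Em; split=> //.
  by rewrite mulrS; ring.
pose q := Num.bound ((k n)`_m / (k n)`_0).
have k0 := @pos_k n 0%N (leq0n _); have km := @pos_k n m (leqnn _).
have := @pos_k (n + q)%N m (leqnn _); rewrite (E q).2 subr_gt0 -mulr_natr.
rewrite mulrC -ltr_pdivlMr// => /ltW; rewrite leNgt => /negP; apply.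
by apply: archi_boundP; rewrite divr_ge0// ltW.
Qed.

(** Descending from the next branch [true] to the time [p], the two previous
    inequalities telescope, and bound the squared gap at time [p] by the energy
    spent after [p]. *)
Let small_gap (e : R) : 0 < e -> exists n, forall p, (n <= p)%N -> `|g p| <= e.
Proof.
move=> e0.
have nd : {homo energy^~ s0 : n p / (n <= p)%N >-> n <= p}.
  by rewrite (_ : s0 = (s0.1.1, s0.1.2, s0.2)); [exact: energy_nd|case: (s0) => -[]].
have cv : cvgn (energy^~ s0).
  apply: nondecreasing_is_cvgn => //.
  by have [M HM] := bounded; exists M => _ [n _ <-]; exact: ltW.
have d0 : 0 < e ^+ 2 / 4 / 2 by rewrite !divr_gt0 ?exprn_gt0.
move/cvgrPdist_lt: (cv) => /(_ _ d0) [n _ Hn].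
exists n => p np.
have tail q : (p <= q)%N -> 4 * (energy q s0 - energy p s0) <= e ^+ 2.
  move=> pq; have := Hn p np; have := Hn q (leq_trans np pq) => /=.
  by rewrite !ltr_norml => /andP[? ?] /andP[? ?]; lra.
have [q pq wq] := recurrent p.
have H d : (p <= q - d)%N -> g (q - d)%N ^+ 2 <= 4 * (energy q.+1 s0 - energy (q - d)%N s0).
  elim: d => [|d IH] pd.
    rewrite subn0 /energy big_ord_recr/= addrAC subrr add0r /gain_of.
    rewrite -/(s q) -/(a q) -/(b q) -/(k q) -/(w q) wq.
    exact: gap_sqr_true.
  have [qd|qd] := leqP q d.
    have E : (q - d.+1 = q - d)%N by lia.
    by rewrite E in pd *; exact: IH.
  have qE : (q - d = (q - d.+1).+1)%N by lia.
  have pd' : (p <= q - d)%N by rewrite qE ltnW// ltnS.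
  have {}IH := IH pd'.
  set r := (q - d.+1)%N in pd qE *.
  have Er : energy (q - d)%N s0 = energy r s0 + gain (w r) (a r) (b r).
    by rewrite qE /energy big_ord_recr.
  rewrite Er in IH.
  have nd' : energy r.+1 s0 <= energy q.+1 s0 by apply: nd; lia.
  have {}nd' : energy r s0 + gain (w r) (a r) (b r) <= energy q.+1 s0.
    by rewrite -Er qE.
  case wr : (w r) IH nd' => IH nd'.
    have := @gap_sqr_true (a r) (b r) (pos_a r) (@max_a r).
    by rewrite -/(g r) => h; lra.
  have := @gap_sqr_false (a r) (b r) (pos_a r) (@max_a r).
  move: IH; rewrite qE /g aS bS wr => IH h; lra.
have := H (q - p)%N; rewrite subKn// => /(_ (leqnn _)) => h.
rewrite -(@ler_pXn2r _ 2) ?nnegrE ?(ltW e0)// -normrX ger0_norm ?sqr_ge0//.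
by rewrite (le_trans h)// tail// leqW.
Qed.

Let chain e r n := forall i, (i < r)%N -> (i < m)%N -> `|u n i - u n i.+1| <= e.

Let uS n i : (0 < i <= m)%N -> u n.+1 i = u n (if w n then i.-1 else i).
Proof. by move=> im; rewrite /u aS bS slope_dual. Qed.

(** When all gaps are at most [d], the slopes [1] and [m] are within [2 * d]
    after the first branch [true]: they come from the slopes [0] and [m - 1],
    both within [d] of the new slope [0], and they do not move until the next
    branch [true].  So the slopes [0] and [1] are always within [3 * d].  A
    branch [true] shifts all slopes by one place, hence it lengthens the chain
    of close neighbours by one, and after [m] of them all slopes are close. *)
Lemma slopes_contract (e : R) : 0 < e ->
  exists n, forall p, (n <= p)%N -> forall i, (i <= m)%N -> `|u p i - u p 0| <= e.
Proof.
move=> e0; pose d := e / (3 * m%:R).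
have mR : 0 < m%:R :> R by rewrite ltr0n.
have d0 : 0 < d by rewrite divr_gt0// mulr_gt0.
have [n1 Hn1] := small_gap d0.
have [n2 n12 wn2] := recurrent n1.
(* [n2] is the time of a first branch [true] after the gaps are small. *)
have I1 n : (n2 < n)%N -> `|u n 1 - u n m| <= 2 * d.
  elim: n => [//|n IH] n2n.
  have base : w n -> (n1 <= n)%N -> `|u n.+1 1 - u n.+1 m| <= 2 * d.
    move=> wn n1n; rewrite uS ?m0// wn.
    have -> : u n 0 - u n.+1 m = (u n.+1 0 - u n.+1 m) - (u n.+1 0 - u n 0) by ring.
    rewrite (le_trans (ler_normB _ _))// mulr_natl mulr2n lerD//.
      by apply: (Hn1 n.+1); rewrite leqW.
    rewrite (le_trans _ (Hn1 n n1n))// /u aS bS.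
    exact: slope_dual0_near.
  have [nn2|nn2] := leqP n n2.
    by apply: base; [rewrite (_ : n = n2)//; lia|lia].
  case wn : (w n); first by apply: base => //; lia.
  by rewrite !uS ?m0 ?leqnn// wn; exact: IH.
have I2 n : (n2 < n)%N -> `|u n 0 - u n 1| <= 3 * d.
  move=> n2n; have -> : u n 0 - u n 1 = (u n 0 - u n m) - (u n 1 - u n m) by ring.
  rewrite (le_trans (ler_normB _ _))//.
  have := I1 n n2n; have : `|g n| <= d by apply: Hn1; lia.
  by rewrite /g gap_slope -/(u n 0) -/(u n m); lra.
have J0 r n : (n2 < n)%N -> chain (3 * d) r n -> chain (3 * d) r n.+1.
  move=> n2n H [|i] ir im; first by apply: I2; rewrite ltnS ltnW.
  rewrite !uS ?im ?(ltnW im)//; case: (w n) => /=; last exact: H.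
  by apply: H; lia.
have J1 r n : (n2 < n)%N -> w n -> chain (3 * d) r n -> chain (3 * d) r.+1 n.+1.
  move=> n2n wn H [|i] ir im; first by apply: I2; rewrite ltnS ltnW.
  by rewrite !uS ?im ?(ltnW im)// wn; apply: H; lia.
have Jmon r n p : (n2 < n)%N -> (n <= p)%N -> chain (3 * d) r n -> chain (3 * d) r p.
  move=> n2n; elim: p => [|p IH]; first by rewrite leqn0 => /eqP <-.
  rewrite leq_eqVlt => /orP[/eqP <-//|np] H.
  by apply: J0; [lia|apply: IH; [rewrite -ltnS|]].
have Jr r : exists2 n, (n2 < n)%N & chain (3 * d) r n.
  elim: r => [|r [n n2n H]]; first by exists n2.+1.
  have [p np wp] := recurrent n.
  exists p.+1; first by lia.
  by apply: J1 => //; [lia|exact: Jmon np H].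
have [n n2n H] := Jr m.
exists n => p np i im.
have {}H := Jmon _ _ _ n2n np H.
suff : `|u p i - u p 0| <= i%:R * (3 * d).
  move=> h; rewrite (le_trans h)// (@le_trans _ _ (m%:R * (3 * d)))//.
    by rewrite ler_wpM2r ?ler_nat// mulr_ge0// ltW.
  by rewrite /d le_eqVlt; apply/orP; left; apply/eqP; field; rewrite gt_eqF.
elim: i im => [|i IH] im; first by rewrite subrr normr0 mul0r.
have -> : u p i.+1 - u p 0 = (u p i - u p 0) - (u p i - u p i.+1) by ring.
rewrite (le_trans (ler_normB _ _))// -natr1 mulrDl mul1r lerD//.
  by apply: IH; rewrite ltnW.
exact: H.
Qed.

End contraction.

(** * Rebuilding a point from its past *)
Section reconstruction.
Context {R : realType} {m : nat}.
Local Notation vec := (m.+1.-tuple R).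
Implicit Types (l k a b : vec) (w : bool).

(** The number [dot b k] is a mean of the slopes with the weights [a_i * k_i],
    whose sum is [N]. *)
Lemma dot_close (N d c : R) a b k : positive a -> (forall i, (i <= m)%N -> 0 <= k`_i) ->
  dot a k = N -> (forall i, (i <= m)%N -> `|slope a b i - c| <= d) ->
  `|dot b k - c * N| <= d * N.
Proof.
move=> a0 k0 <- H; rewrite /dot !mulr_sumr -sumrB.
rewrite (le_trans (ler_norm_sum _ _ _))//; apply: ler_sum => i _.
have im : (i <= m)%N by rewrite -ltnS.
have ai := a0 _ im; have ki := k0 _ im.
have -> : b`_i * k`_i - c * (a`_i * k`_i) = (slope a b i - c) * (a`_i * k`_i).
  by rewrite /slope; field; rewrite gt_eqF.
rewrite normrM [X in _ * X]ger0_norm; last by rewrite mulr_ge0// ltW.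
by rewrite ler_wpM2r ?H// mulr_ge0// ltW.
Qed.

End reconstruction.

Section maps.
Context {R : realType} {m : nat}.
Local Notation vec := (m.+1.-tuple R).
Local Notation point := (vec * vec)%type.
Implicit Types (l k a b : vec) (w : bool) (x : point).
Hypothesis m0 : (0 < m)%N.

Lemma triangle_le l i j : triangle l -> (i <= j <= m)%N -> l`_j <= l`_i.
Proof.
move=> [dec _] /andP[]; elim: j => [|j IH]; first by rewrite leqn0 => /eqP ->.
rewrite leq_eqVlt => /orP[/eqP ->//|ij] jm.
by rewrite (le_trans (ltW (dec _ jm)))// IH// ltnW.
Qed.

Lemma triangle_positive l : triangle l -> positive l.
Proof.
move=> tl i im; have [_ lm] := tl.
by rewrite (lt_le_trans lm)// triangle_le// im leqnn.
Qed.

Lemma triangle_headmax l : triangle l -> headmax l.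
Proof. by move=> tl i im; rewrite triangle_le. Qed.

(** The branch that [T] uses at [l]; compare [branch], which looks at the past. *)
Definition side l : bool := l \in (triangle0 : set vec).

Definition generic : set vec := triangle `\` triangleD.

Lemma generic_side l : generic l -> (if side l then triangle0 l else triangle1 l).
Proof.
move=> [tl nD]; rewrite /side; case: ifPn => [/set_mem//|/negP n0].
have [//|t1] := pselect (triangle1 l).
exfalso; apply: nD; rewrite triangleDE; split => // -[t0|//].
by apply: n0; rewrite inE.
Qed.

Lemma triangle01 l : triangle0 l -> triangle1 l -> False.
Proof. by move=> [_ /= h] [_ /= h']; move: (lt_trans h h'); rewrite ltxx. Qed.

Lemma triangle_map_generic l : generic l -> triangle_map l = step_l (side l) l.
Proof.
move=> gl; have := generic_side gl; rewrite /triangle_map -/(side l).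
case: (side l) => // h; by rewrite mem_set.
Qed.

Lemma ext_triangle_map_generic x : generic x.1 ->
  ext_triangle_map x = (step_l (side x.1) x.1, step_k (side x.1) x.2).
Proof.
move=> gl; have := generic_side gl; rewrite /ext_triangle_map -/(side x.1).
case: (side x.1) => // h; by rewrite mem_set.
Qed.

Lemma ext_triangle_map_fst x : (ext_triangle_map x).1 = triangle_map x.1.
Proof.
rewrite /ext_triangle_map /triangle_map; case: ifP => // _.
by case: ifP.
Qed.

Lemma iter_ext_fst n x : (iter n ext_triangle_map x).1 = iter n triangle_map x.1.
Proof. by elim: n => [//|n IH] /=; rewrite ext_triangle_map_fst IH. Qed.

Lemma triangle_step w l : (if w then triangle0 l else triangle1 l) -> triangle (step_l w l).
Proof.
case: w => -[tl /= h]; have [dec lm] := tl.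
  split => [i im|]; rewrite !nth_step_l0// ?(ltnW im)//.
    rewrite im; case: ltnP => im'; first exact: dec.
    by rewrite (_ : i.+1 = m); [lra|lia].
  by rewrite ltnn subr_gt0; apply: dec.
have lm0 := triangle_positive tl (leqnn m).
split => [i im|]; rewrite !nth_step_l1// ?(ltnW im)//=.
  case: eqP => [->|_]; last exact: dec.
  by lra.
by rewrite gtn_eqF.
Qed.

Lemma triangle_dual w l : triangle l ->
  if w then triangle0 (dual w l) else triangle1 (dual w l).
Proof.
move=> tl; have [dec lm] := tl.
have l0 : 0 < l`_0 by exact: triangle_positive.
have t w' : triangle (dual w' l).
  split => [i im|]; last by exact/positive_dual/leqnn/triangle_positive.
  rewrite !nth_dual// ?(ltnW im)//=; case: w'; case: eqP => [->|i0].
  - by lra.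
  - by rewrite -[X in l`_X]prednK; [apply: dec|]; lia.
  - by have := dec 0%N m0; lra.
  - exact: dec.
have lm1 := dec m.-1; rewrite prednK// in lm1.
case: w; (split; first exact: t); rewrite /= !nth_dual//= ?gtn_eqF//.
  by have := lm1 (leqnn _); lra.
by have := dec 0%N m0; lra.
Qed.

Lemma generic_dual w l : triangle l -> generic (dual w l) /\ side (dual w l) = w.
Proof.
move=> tl; have := triangle_dual w tl; case: w => h; split.
- by split; [case: h|rewrite triangleDE => -[_]; apply; left].
- by rewrite /side mem_set.
- by split; [case: h|rewrite triangleDE => -[_]; apply; right].
- by apply/negbTE/negP => /set_mem h'; exact: triangle01 h' h.
Qed.

(** The branch just used can be read off from the new [k]. *)
Lemma branch_step w k : positive k -> branch (step_k w k) = w.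
Proof.
move=> k0; have k00 := k0 0%N (leq0n _); have k01 := k0 1%N m0.
have km := k0 m (leqnn _).
rewrite /branch; case: w => /=.
  by rewrite !nth_step_k0// ltnn gtn_eqF//=; lra.
by apply/negbTE; rewrite !nth_step_k1// ltnn m0 -leNgt; lra.
Qed.

(** Points with [k_0 = k_m] are not in the image of the extended map. *)
Lemma step_tie w k : positive k -> (step_k w k)`_0 != (step_k w k)`_m.
Proof.
move=> k0; have k00 := k0 0%N (leq0n _); have k01 := k0 1%N m0.
have km := k0 m (leqnn _); case: w => /=.
  by rewrite !nth_step_k0// ltnn (gtn_eqF m0)//= gt_eqF// ltrDl.
by rewrite !nth_step_k1// ltnn m0 lt_eqF// ltrDl.
Qed.

Lemma positive_step w k : positive k -> positive (step_k w k).
Proof.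
move=> k0 i im; have k00 := k0 0%N (leq0n _); have k01 := k0 1%N m0.
have km := k0 m (leqnn _); case: w => /=.
  rewrite nth_step_k0//; case: eqP => _; first by lra.
  by case: ltnP => // ?; exact: k0.
by rewrite nth_step_k1//; case: ltnP => ?; [exact: k0|lra].
Qed.

Lemma positive_back k : positive k -> k`_0 != k`_m -> positive (back (branch k) k).
Proof.
move=> k0 kk; rewrite /branch; case: ltP => kk' i im.
  rewrite nth_back0//; case: eqP => _; first exact: k0.
  by case: eqP => _; [rewrite subr_gt0|apply: k0; lia].
rewrite nth_back1//; case: ltnP => _; first exact: k0.
by rewrite subr_gt0 lt_neqAle kk.
Qed.

Lemma Dom_TP l : Dom_T l <-> forall n, generic (iter n triangle_map l).
Proof.
split => [[tl H] n|H].
  elim: n => [|n IH]; first by split => //; exact: (H 0%N).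
  split; last exact: (H n.+1).
  by rewrite /= triangle_map_generic//; exact/triangle_step/generic_side.
by split => [|n]; [exact: (H 0%N).1|exact: (H n).2].
Qed.

(** The domain of the extended map puts a condition on the orbit of the first
    component only. *)
Lemma Dom_eTP N x : Dom_eT N x <-> [/\ Dom_T x.1, positive x.2 & dot x.1 x.2 = N].
Proof.
split => [[[tx kx sx] H]|[[tx H] kx sx]].
  split => //.
    by split => // n; rewrite -iter_ext_fst; exact: H.
  by move=> i im; exact: (kx (Ordinal (im : (i < m.+1)%N))).
split; last by move=> n; rewrite iter_ext_fst.
split => // i; apply: kx; by rewrite -ltnS.
Qed.

Lemma Dom_T_generic l : Dom_T l -> generic l.
Proof. by move/Dom_TP => /(_ 0%N). Qed.

Lemma Dom_T_map l : Dom_T l -> Dom_T (triangle_map l).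
Proof. by move=> /Dom_TP H; apply/Dom_TP => n; rewrite -iterSr; exact: H. Qed.

Lemma Dom_T_dual w l : Dom_T l -> Dom_T (dual w l) /\ triangle_map (dual w l) = l.
Proof.
move=> Dl; have [tl _] := Dl; have [gd sd] := generic_dual w tl.
have Td : triangle_map (dual w l) = l by rewrite triangle_map_generic// sd dualK.
split => //; apply/Dom_TP => -[//|n]; rewrite iterSr Td.
by move/Dom_TP: Dl; exact.
Qed.

Lemma Dom_eT_map N x : Dom_eT N x -> Dom_eT N (ext_triangle_map x).
Proof.
move=> /Dom_eTP[Dx kx sx]; apply/Dom_eTP; rewrite ext_triangle_map_fst.
split; first exact: Dom_T_map.
  rewrite ext_triangle_map_generic//; last exact: Dom_T_generic.
  exact: positive_step.
rewrite -ext_triangle_map_fst ext_triangle_map_generic ?dot_step//.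
exact: Dom_T_generic.
Qed.

Definition ext_back x : point := (dual (branch x.2) x.1, back (branch x.2) x.2).

Lemma ext_back_map N x : Dom_eT N x -> ext_back (ext_triangle_map x) = x.
Proof.
move=> /Dom_eTP[Dx kx sx]; rewrite ext_triangle_map_generic; last exact: Dom_T_generic.
by rewrite /ext_back/= branch_step// step_lK// step_kK//; case: x {Dx kx sx}.
Qed.

Lemma ext_map_back x : Dom_T x.1 -> ext_triangle_map (ext_back x) = x.
Proof.
move=> Dx; have [tl _] := Dx; have [gd sd] := generic_dual (branch x.2) tl.
by rewrite ext_triangle_map_generic//= sd dualK// backK//; case: x {Dx tl gd sd}.
Qed.

Lemma Dom_eT_map_tie N x : Dom_eT N x ->
  (ext_triangle_map x).2`_0 != (ext_triangle_map x).2`_m.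
Proof.
move=> /Dom_eTP[Dx kx sx]; rewrite ext_triangle_map_generic ?step_tie//.
exact: Dom_T_generic.
Qed.

(** A section of the projection, with all entries of [k] equal. *)
Definition lift (N : R) l : point := (l, [tuple N / (\sum_(j < m.+1) l`_j) | i < m.+1]).

Lemma nth_lift N l i : (i <= m)%N -> (lift N l).2`_i = N / (\sum_(j < m.+1) l`_j).
Proof. exact: (@nth_mktuple_nat _ _ (fun=> N / (\sum_(j < m.+1) l`_j))). Qed.

Lemma sum_gt0 l : positive l -> 0 < \sum_(j < m.+1) l`_j.
Proof.
move=> l0; rewrite (sum_first (fun i => l`_i)) ltr_pwDl ?l0// sumr_ge0// => i _.
by rewrite ltW// l0.
Qed.

Lemma dot_lift N l : positive l -> dot l (lift N l).2 = N.
Proof.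
move=> l0; have s0 := sum_gt0 l0.
rewrite /dot (eq_bigr (fun i : 'I_m.+1 => l`_i * (N / (\sum_(j < m.+1) l`_j)))).
  by rewrite -mulr_suml; field; rewrite gt_eqF.
by move=> i _; rewrite nth_lift// -ltnS.
Qed.

Lemma Dom_eT_lift N l : 0 < N -> Dom_T l -> Dom_eT N (lift N l).
Proof.
move=> N0 Dl; have l0 := triangle_positive Dl.1; apply/Dom_eTP; split => //=.
  by move=> i im; rewrite nth_lift// divr_gt0// sum_gt0.
exact: dot_lift.
Qed.

Definition basis c : vec := [tuple (i == c :> nat)%:R | i < m.+1].

Lemma dot_basis c k : (c <= m)%N -> dot (basis c) k = k`_c.
Proof.
move=> cm; have cE i : (i <= m)%N -> (basis c)`_i = (i == c)%:R.
  exact: (@nth_mktuple_nat _ _ (fun i => (i == c)%:R)).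
rewrite /dot (bigD1 (Ordinal (cm : (c < m.+1)%N)))//= cE// eqxx mul1r big1 ?addr0//.
move=> i ic; rewrite cE; last by rewrite -ltnS.
by rewrite (_ : (i == c :> nat) = false) ?mul0r//; apply/negbTE.
Qed.

Section backward_orbit.
Variables (N : R) (x : nat -> point).
Hypothesis N0 : 0 < N.
Hypothesis Dx : forall n, Dom_eT N (x n).
Hypothesis xS : forall n, ext_triangle_map (x n.+1) = x n.

Let Tx n : Dom_T (x n).1. Proof. by have /Dom_eTP[] := Dx n. Qed.
Let px n : positive (x n).2. Proof. by have /Dom_eTP[] := Dx n. Qed.

Let x_back n : x n.+1 = ext_back (x n).
Proof. by rewrite -[X in _ = ext_back X]xS (ext_back_map (Dx _)). Qed.

(** Along a backward orbit, [n] steps of the extended map act on the fibre of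
    the [n]-th preimage by a matrix, and the row vector [b'] is the product of
    [b] with it. *)
Lemma iter_pull_orbit b n : exists b',
  iter n pull ((x 0%N).1, b, (x 0%N).2) = ((x n).1, b', (x n).2) /\
  forall k, dot b (iter n ext_triangle_map ((x n).1, k)).2 = dot b' k.
Proof.
elim: n => [|n [b' [H1 H2]]]; first by exists b.
exists (dual (branch (x n).2) b'); split; first by rewrite iterS H1 x_back.
move=> k; rewrite iterSr ext_triangle_map_generic /=; last exact: Dom_T_generic.
have [gd sd] := generic_dual (branch (x n).2) (Tx n).1.
rewrite x_back/= sd dualK// H2.
by rewrite -(dot_dual m0 (branch (x n).2) b') step_kK.
Qed.

(** The lift of the [n]-th preimage and the true preimage lie in the same
    fibre, so after [n] steps they differ by at most [N] times the diameter of
    the set of the slopes. *)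
Lemma reconstruct c : (c <= m)%N ->
  (exists M, forall n, energy n ((x 0%N).1, basis c, (x 0%N).2) < M) ->
  (iter n ext_triangle_map (lift N (x n).1)).2`_c @[n --> \oo] --> (x 0%N).2`_c.
Proof.
move=> cm bounded; apply/cvgrPdist_le => e e0.
pose s0 := ((x 0%N).1, basis c, (x 0%N).2).
have d0 : 0 < e / (2 * N) by rewrite divr_gt0// mulr_gt0.
have [n _ Hn] : \forall p \near \oo, forall i, (i <= m)%N ->
    `|slope (x p).1 (iter p pull s0).1.2 i
      - slope (x p).1 (iter p pull s0).1.2 0| <= e / (2 * N).
  have E p : (iter p pull s0).1.1 = (x p).1 /\ (iter p pull s0).2 = (x p).2.
    by have [b' [-> _]] := iter_pull_orbit (basis c) p.
  have [|||n Hn] := @slopes_contract R m m0 s0 _ _ _ bounded _ d0.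
  - exact: triangle_positive (Tx 0).1.
  - exact: triangle_headmax (Tx 0).1.
  - by move=> p; rewrite (E p).2.
  by exists n => // p np i im; rewrite -(E p).1; exact: Hn.
exists n => // p /= np; have {}Hn := Hn p np.
have [b' [E H]] := iter_pull_orbit (basis c) p.
rewrite -/s0 in E; rewrite E /= in Hn.
rewrite -[X in `|X - _|]dot_basis// -[X in `|_ - X|]dot_basis// H.
have -> : dot (basis c) (x 0%N).2 = dot b' (x p).2.
  rewrite -H; congr dot; have -> : ((x p).1, (x p).2) = x p by case: (x p).
  have -> // : forall q, iter q ext_triangle_map (x q) = x 0%N.
  by elim=> [//|q IH]; rewrite iterSr xS.
set u := slope (x p).1 b' 0 in Hn.
have pos := triangle_positive (Tx p).1.
have C1 := @dot_close _ _ N _ u (x p).1 b' (x p).2 pos _ _ Hn.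
have C2 := @dot_close _ _ N _ u (x p).1 b' (lift N (x p).1).2 pos _ _ Hn.
have {}C1 : `|dot b' (x p).2 - u * N| <= e / (2 * N) * N.
  by apply: C1 => [i im|]; [exact/ltW/px|have /Dom_eTP[] := Dx p].
have {}C2 : `|dot b' (lift N (x p).1).2 - u * N| <= e / (2 * N) * N.
  apply: C2 => [i im|]; last exact: dot_lift.
  by rewrite nth_lift// divr_ge0// ltW// sum_gt0.
have -> : dot b' (x p).2 - dot b' (lift N (x p).1).2 =
  (dot b' (x p).2 - u * N) - (dot b' (lift N (x p).1).2 - u * N) by ring.
rewrite (le_trans (ler_normB _ _))// (le_trans (lerD C1 C2))//.
by rewrite le_eqVlt; apply/orP; left; apply/eqP; field; rewrite gt_eqF.
Qed.

End backward_orbit.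

End maps.

(** * The measure as the Lebesgue measure of a cone *)
Section products.
Context d1 d2 (T1 : measurableType d1) (T2 : measurableType d2) (R : realType).
Variable m1 : {measure set T1 -> \bar R}.
Variable m2 : {sigma_finite_measure set T2 -> \bar R}.
Local Open Scope ereal_scope.

Lemma product_measure_sections A :
  (m1 \x m2) A = \int[m1]_x m2 [set y | A (x, y)].
Proof.
rewrite /product_measure1; apply: eq_integral => x _ /=; congr (m2 _).
by apply/seteqP; split => y; rewrite /xsection/= inE.
Qed.

Lemma measurable_fun_sections (A : set (T1 * T2)) : measurable A ->
  measurable_fun setT (fun x => m2 [set y | A (x, y)]).
Proof.
move=> mA; have := @measurable_fun_xsection _ _ _ _ R m2 A mA.
congr measurable_fun; apply/funext => x /=; congr (m2 _).
by apply/seteqP; split => y; rewrite /xsection/= inE.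
Qed.

Lemma measurable_xslice (A : set (T1 * T2)) x : measurable A -> measurable [set y | A (x, y)].
Proof.
move=> mA; apply: (@measurable_preimage _ _ _ _ (fun y => (x, y))) => //.
exact: measurable_fun_pair.
Qed.

Lemma measurable_yslice (A : set (T1 * T2)) y : measurable A -> measurable [set x | A (x, y)].
Proof.
by move=> mA; apply: (@measurable_preimage _ _ _ _ (fun x => (x, y))) => //.
Qed.

Lemma product_measure_preimage (f : T1 -> T1) (g : T2 -> T2) (A : set (T1 * T2)) :
  measurable_fun setT f -> measurable_fun setT g ->
  (forall B, measurable B -> m1 (f @^-1` B) = m1 B) ->
  (forall B, measurable B -> m2 (g @^-1` B) = m2 B) ->
  measurable A -> (m1 \x m2) ((fun z => (f z.1, g z.2)) @^-1` A) = (m1 \x m2) A.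
Proof.
move=> mf mg pf pg mA; rewrite !product_measure_sections.
pose F x := m2 [set y | A (x, y)].
have mF : measurable_fun setT F := measurable_fun_sections mA.
transitivity (\int[m1]_x F (f x)).
  apply: eq_integral => x _; rewrite /F -[RHS]pg; last exact: measurable_xslice.
  by congr (m2 _).
have := @ge0_integral_pushforward _ _ _ _ R f mf m1 setT F measurableT mF
  (fun y _ => measure_ge0 _ _).
rewrite preimage_setT => <-.
by apply: eq_measure_integral => B mB _; exact: pf.
Qed.

End products.

Section cone.
Context {R : realType} {m : nat}.
Local Notation vec := (m.+1.-tuple R).
Local Notation point := (vec * vec)%type.
Implicit Types (l k a b : vec) (w : bool) (x : point).
Hypothesis m0 : (0 < m)%N.
Variable N : R.
Hypothesis N0 : 0 < N.
Local Notation leb := (@lebesgue_measure R).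

Definition lebn2 : {measure set point -> \bar R} :=
  (@lebn R m.+1 \x @lebn R m.+1)%E.

(** The point of the level set of [N] on the ray of [x]. *)
Definition rescale x : point := (x.1, scale_tuple (N / dot x.1 x.2) x.2).

Lemma measurable_rescale : measurable_fun setT rescale.
Proof.
apply: measurable_fun_pair => //; apply: measurable_scale_tuple => //.
apply: measurable_funM => //; apply: (measurableT_comp measurable_invr).
exact: measurable_dot.
Qed.

Definition cone (A : set point) : set point :=
  [set x | 0 < dot x.1 x.2 < N /\ (A `&` Dom_eT N) (rescale x)].

Lemma measurable_cone A : measurable A -> measurable (cone A).
Proof.
move=> mA; rewrite (_ : cone A =
  [set x | 0 < dot x.1 x.2] `&` ([set x | dot x.1 x.2 < N] `&`
    (rescale @^-1` (A `&` Dom_eT N)))).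
  apply: measurableI; first by apply: measurable_lt => //; exact: measurable_dot.
  apply: measurableI; first by apply: measurable_lt => //; exact: measurable_dot.
  apply: measurable_preimage; first exact: measurable_rescale.
  by apply: measurableI => //; exact: measurable_Dom_eT.
apply/seteqP; split => x /=; first by case=> /andP[].
by move=> [? [? ?]]; split => //; apply/andP.
Qed.

(** The fibre of [A] above [l], in the coordinates [k_1, ..., k_m]. *)
Definition slice (A : set point) l : set (m.-tuple R) :=
  [set t | (A `&` Dom_eT N) (Pm_point N (l, t))].

(** Its value is [1 / (m + 1)], the integral of [s ^ m] over the unit interval. *)
Definition cone_const : \bar R := (\int[leb]_s ((s ^+ m)%:E * (\1_`]0%R, 1%R[ s)%:E))%E.

Lemma measurable_slices A : measurable A ->
  measurable [set z : vec * m.-tuple R | (A `&` Dom_eT N) (Pm_point N z)].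
Proof.
move=> mA; apply: (@measurable_preimage _ _ _ _ (Pm_point N)).
  exact: measurable_Pm_point.
by apply: measurableI => //; exact: measurable_Dom_eT.
Qed.

Lemma Pm_point_pos (c : vec * m.-tuple R) : Dom_eT N (Pm_point N c) -> 0 < c.1`_0.
Proof. by move=> [[tc _ _] _]; exact: triangle_positive tc 0%N (leq0n _). Qed.

Lemma mu_eT_slices A : measurable A ->
  mu_eT N A = (\int[lebn m.+1]_l ((l`_0)^-1%:E * lebn m (slice A l)))%E.
Proof.
move=> mA; rewrite /mu_eT integral_mkcond.
have mS := measurable_slices mA.
rewrite fubini_tonelli1; last 2 first.
- apply/(measurable_restrictT _ _).1 => //.
  apply: measurable_funTS; apply/measurable_EFinP.
  apply: (measurableT_comp measurable_invr).
  by apply: (measurableT_comp (measurable_nth _)).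
- move=> c; rewrite patchE; case: ifPn => // /set_mem[_ /Pm_point_pos c0].
  by rewrite lee_fin invr_ge0 ltW.
apply: eq_integral => l _; rewrite /fubini_F.
have [l0|l0] := ltP 0 l`_0; last first.
  rewrite (_ : slice A l = set0) ?measure0 ?mule0.
    rewrite integral0_eq// => t _; rewrite patchE; case: ifPn => // /set_mem[_ /Pm_point_pos] /=.
    by rewrite ltNge l0.
  by apply/seteqP; split => t // [_ /Pm_point_pos] /=; rewrite ltNge l0.
transitivity (\int[lebn m]_t ((l`_0)^-1%:E * (\1_(slice A l) t)%:E))%E.
  apply: eq_integral => t _; rewrite patchE indicE.
  have -> : ((l, t) \in Pm_point N @^-1` (A `&` Dom_eT N)) = (t \in slice A l).
    by apply/idP/idP => /set_mem h; apply/mem_set.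
  by case: (_ \in _); rewrite ?mule1 ?mule0.
have ms : measurable (slice A l) by exact: (measurable_xslice l mS).
rewrite ge0_integralZl//; last 2 first.
- exact/measurable_EFinP.
- by rewrite lee_fin invr_ge0 ltW.
by rewrite integral_indic// setIT.
Qed.

(** Replace [k_0] by [s = dot l k / N]; this is affine in [k_0] with slope
    [l_0 / N].  At a fixed [s], the remaining coordinates range over [s] times
    the slice, which gives the factor [s ^ m]. *)
Lemma cone_fiber A l : measurable A -> 0 < l`_0 ->
  lebn m.+1 [set k | cone A (l, k)] =
  ((N / l`_0)%:E * (cone_const * lebn m (slice A l)))%E.
Proof.
move=> mA l0; have mC := measurable_xslice l (measurable_cone mA).
rewrite lebnSr//.
pose r (t : m.-tuple R) : R := \sum_(i < m) l`_i.+1 * t`_i.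
have dotE (x : R) t : dot l (cons_tuple x t) = l`_0 * x + r t.
  by rewrite /dot (sum_first (fun i => l`_i * (cons_tuple x t)`_i)).
pose B : set (R * m.-tuple R) :=
  [set z | (0 < z.1 < 1) /\ slice A l (scale_tuple z.1^-1 z.2)].
have mB : measurable B.
  rewrite (_ : B = (fst @^-1` `]0%R, 1%R[%classic) `&`
      ((fun z => scale_tuple z.1^-1 z.2) @^-1` slice A l)); last first.
    by apply/seteqP; split => z; rewrite /B /= in_itv.
  apply: measurableI; first by apply: measurable_preimage => //; exact: measurable_itv.
  apply: measurable_preimage; last exact: measurable_xslice (measurable_slices mA).
  by apply: measurable_scale_tuple => //; apply: (measurableT_comp measurable_invr).
transitivity (\int[lebn m]_t ((N / l`_0)%:E * leb [set s | B (s, t)]))%E.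
  apply: eq_integral => t _.
  have mBt : measurable [set s : measurableTypeR R | B (s, t)] by exact: measurable_yslice.
  have c0 : 0 < l`_0 / N by rewrite divr_gt0.
  have := lebesgue_affine (r t / N) c0 mBt; rewrite invf_div => <-.
  congr (leb _); apply/seteqP.
  suff E (x : R) : (0 < dot l (cons_tuple x t) < N) -> rescale (l, cons_tuple x t) =
      Pm_point N (l, scale_tuple (l`_0 / N * x + r t / N)^-1 t).
    have E' (x : R) : (0 < dot l (cons_tuple x t) < N) = (0 < l`_0 / N * x + r t / N < 1).
      rewrite mulrAC -mulrDl dotE ltr_pdivrMr// mul1r.
      by rewrite pmulr_lgt0 ?invr_gt0.
    split => x /= [h1 h2].
      by split; [rewrite -E'|rewrite /slice /= -E].
    by rewrite -E' in h1; split => //; rewrite E.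
  move=> h; rewrite /rescale /Pm_point /=; congr pair.
  have dN : l`_0 / N * x + r t / N = dot l (cons_tuple x t) / N.
    by rewrite dotE; field; rewrite gt_eqF.
  have /andP[d0 _] := h.
  rewrite dN invf_div; set D := dot _ _ in d0 h *.
  apply: val_inj => /=; congr (_ :: _).
  rewrite (eq_bigr (fun i : 'I_m => N / D * (l`_i.+1 * t`_i))).
    rewrite -mulr_sumr -/(r t) (_ : r t = D - l`_0 * x); last by rewrite /D dotE; ring.
    by field; rewrite !gt_eqF.
  by move=> i _; rewrite (nth_map 0) ?size_tuple//; ring.
rewrite ge0_integralZl//; last 2 first.
- have := @measurable_fun_ysection _ _ (measurableTypeR R) (m.-tuple R) R leb B mB.
  congr measurable_fun; apply/funext => t /=; congr (leb _).
  by apply/seteqP; split => y; rewrite /ysection/= inE.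
- by rewrite lee_fin divr_ge0// ltW.
congr (_ * _)%E.
transitivity ((leb \x lebn m)%E B).
  rewrite product_measure_swap//; apply: eq_integral => t _; congr (leb _).
  by apply/seteqP; split => y; rewrite /ysection/= inE.
rewrite product_measure_sections /cone_const.
transitivity (\int[leb]_s ((lebn m (slice A l)) * ((s ^+ m)%:E * (\1_`]0%R, 1%R[ s)%:E)))%E.
  apply: eq_integral => s _; have [s01|s01] := boolP (0 < s < 1); last first.
    rewrite indicE (_ : (s \in _) = false) ?mule0.
      rewrite (_ : [set y | _] = set0) ?measure0//.
      by apply/seteqP; split => t // [h]; rewrite h in s01.
    by apply/negbTE; apply: contra s01 => /set_mem /=; rewrite in_itv.
  rewrite indicE mem_set ?mule1; last by rewrite /= in_itv.
  have [s0 _] := andP s01.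
  rewrite (_ : [set y | _] = scale_tuple s^-1 @^-1` slice A l); last first.
    by apply/seteqP; split => t; [case|split].
  rewrite lebn_scale ?invr_gt0//; last exact: measurable_xslice (measurable_slices mA).
  by rewrite exprVn invrK muleC.
have mI : measurable (`]0%R, 1%R[%classic : set (measurableTypeR R)) by exact: measurable_itv.
rewrite ge0_integralZl//; first by rewrite muleC.
- apply: emeasurable_funM; apply/measurable_EFinP => //.
move=> s _; rewrite -EFinM lee_fin indicE; case: (boolP (s \in _)) => [|_]; last by rewrite mulr0.
by move=> /set_mem /=; rewrite in_itv/= => /andP[s0 _]; rewrite mulr1 exprn_ge0// ltW.
Qed.

Lemma cone_const_gt0 : (0 < cone_const)%E.
Proof.
have mI (a b : R) : measurable (`]a, b[%classic : set (measurableTypeR R)) by exact: measurable_itv.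
apply: (@lt_le_trans _ _ (\int[leb]_s (((2^-1) ^+ m)%:E * (\1_`]2^-1%R, 1%R[ s)%:E))%E).
  rewrite ge0_integralZl//; last exact/measurable_EFinP.
  rewrite integral_indic// setIT [X in (_ * X)%E]lebesgue_measure_itv/= lte_fin invf_lt1// ltr1n.
  rewrite -EFinD -EFinM lte_fin mulr_gt0 ?exprn_gt0// subr_gt0 invf_lt1//.
  by rewrite ltr1n.
apply: ge0_le_integral => //.
- by apply: emeasurable_funM; apply/measurable_EFinP.
- apply: emeasurable_funM; apply/measurable_EFinP => //.
move=> s _; rewrite !indicE; case: (boolP (s \in _)) => [/set_mem/=|_].
  rewrite in_itv/= => /andP[s2 s1]; rewrite mem_set; last first.
    by rewrite /= in_itv/= s1 andbT (lt_trans _ s2).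
  by rewrite !mule1 lee_fin lerXn2r// ?nnegrE ?ltW// (lt_trans _ s2).
rewrite mule0; case: (boolP (s \in _)) => [/set_mem/=|_]; last by rewrite mule0.
by rewrite in_itv/= => /andP[s0 _]; rewrite mule1 lee_fin exprn_ge0// ltW.
Qed.

Lemma cone_const_fin : (cone_const < +oo)%E.
Proof.
have mI (a b : R) : measurable (`]a, b[%classic : set (measurableTypeR R)) by exact: measurable_itv.
apply: (@le_lt_trans _ _ (\int[leb]_s (\1_`]0%R, 1%R[ s)%:E)%E); last first.
  rewrite integral_indic// setIT [X in (X < _)%E]lebesgue_measure_itv/=.
  by rewrite lte_fin ltr01 oppr0 adde0 ltry.
apply: ge0_le_integral => //.
- move=> s _; rewrite indicE; case: (boolP (s \in _)) => [/set_mem/=|_]; last by rewrite mule0.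
  by rewrite in_itv/= => /andP[s0 _]; rewrite mule1 lee_fin exprn_ge0// ltW.
- apply: emeasurable_funM; apply/measurable_EFinP => //.
- by apply/measurable_EFinP.
move=> s _; rewrite indicE; case: (boolP (s \in _)) => [/set_mem/=|_]; last by rewrite mule0.
rewrite in_itv/= => /andP[s0 s1]; rewrite mule1 lee_fin exprn_ile1 ?ltW//.
Qed.

(** The density [1 / l_0] of [mu] is the Jacobian found in [cone_fiber]. *)
Lemma lebn2_cone A : measurable A ->
  lebn2 (cone A) = (N%:E * cone_const * mu_eT N A)%E.
Proof.
move=> mA; rewrite /lebn2 [LHS]product_measure_sections mu_eT_slices//.
have Q0 l : ~ (0 < l`_0) -> slice A l = set0.
  by move=> l0; apply/seteqP; split => t // [_ /Pm_point_pos].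
rewrite -ge0_integralZl//.
- apply: eq_integral => l _; have [l0|l0] := boolP (0 < l`_0).
    rewrite cone_fiber// EFinM -!muleA; congr (_ * _)%E.
    by rewrite muleCA.
  rewrite Q0 ?measure0 ?mule0; last by apply/negP.
  rewrite (_ : [set y | _] = set0) ?measure0//.
  apply/seteqP; split => k // [_ [_ [[tl _ _] _]]].
  by move/negP: l0; apply; exact: triangle_positive tl 0%N (leq0n _).
- apply: emeasurable_funM.
    apply/measurable_EFinP; apply: (measurableT_comp measurable_invr).
    exact: measurable_nth.
  exact: measurable_fun_sections (measurable_slices mA).
- move=> l _; have [l0|l0] := boolP (0 < l`_0).
    by rewrite mule_ge0// lee_fin invr_ge0 ltW.
  by rewrite Q0 ?measure0 ?mule0//; apply/negP.
- by rewrite mule_ge0// ?lee_fin ltW// cone_const_gt0.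
Qed.

Lemma cone_scale_neq0 : (N%:E * cone_const != 0)%E /\ (N%:E * cone_const \is a fin_num)%E.
Proof.
have h : cone_const \is a fin_num.
  by rewrite ge0_fin_numE ?cone_const_fin// ltW// cone_const_gt0.
by split; [rewrite gt_eqF// mule_gt0// cone_const_gt0|rewrite fin_numM].
Qed.

Lemma mu_eT_eq A B : measurable A -> measurable B ->
  lebn2 (cone A) = lebn2 (cone B) -> mu_eT N A = mu_eT N B.
Proof.
move=> mA mB; rewrite !lebn2_cone//; have [c0 cf] := cone_scale_neq0.
move: (N%:E * cone_const)%E c0 cf => [c| |]// c0 _; rewrite eqe in c0.
move=> h; have : (c^-1%:E * (c%:E * mu_eT N A) = c^-1%:E * (c%:E * mu_eT N B))%E by rewrite h.
by rewrite !muleA -!EFinM mulVf// !mul1e.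
Qed.

Lemma mu_eT_0 A : measurable A -> lebn2 (cone A) = 0%E -> mu_eT N A = 0%E.
Proof.
move=> mA; rewrite lebn2_cone// => /eqP; rewrite mule_eq0.
by have [/negbTE -> _] := cone_scale_neq0 => /eqP.
Qed.

Lemma mu_eT_fin A : measurable A -> (lebn2 (cone A) < +oo)%E -> (mu_eT N A < +oo)%E.
Proof.
move=> mA; rewrite lebn2_cone//; have [c0 cf] := cone_scale_neq0.
rewrite !ltey; apply: contra => /eqP ->.
have : (0 < N%:E * cone_const)%E by rewrite mule_gt0// cone_const_gt0.
by move=> h; rewrite gt0_muley.
Qed.

End cone.

(** * Invariance, null sets and sigma-finiteness *)
Section invariance.
Context {R : realType} {m : nat}.
Local Notation vec := (m.+1.-tuple R).
Local Notation point := (vec * vec)%type.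
Implicit Types (l k a b : vec) (w : bool) (x : point).
Hypothesis m0 : (0 < m)%N.
Variable N : R.
Hypothesis N0 : 0 < N.

Lemma nth_scale (c : R) k i : (i <= m)%N -> (scale_tuple c k)`_i = c * k`_i.
Proof. by move=> im; rewrite /scale_tuple /= (nth_map 0)// size_tuple. Qed.

Lemma dot_scale c l k : dot l (scale_tuple c k) = c * dot l k.
Proof.
rewrite /dot mulr_sumr; apply: eq_bigr => i _; rewrite nth_scale; first by ring.
by rewrite -ltnS.
Qed.

Lemma step_k_scale w c k : step_k w (scale_tuple c k) = scale_tuple c (step_k w k).
Proof.
apply: eq_vec => i im; rewrite nth_scale//; case: w => /=.
  rewrite !nth_step_k0//; case: eqP => _; first by rewrite !nth_scale// mulrDr.
  by case: ltnP => h; rewrite nth_scale.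
by rewrite !nth_step_k1//; case: ltnP => h; rewrite !nth_scale// mulrDr.
Qed.

Lemma back_scale w c k : back w (scale_tuple c k) = scale_tuple c (back w k).
Proof.
apply: eq_vec => i im; rewrite nth_scale//; case: w.
  rewrite !nth_back0//; case: eqP => _; first by rewrite !nth_scale.
  by case: eqP => _; rewrite !nth_scale ?mulrBr//; lia.
by rewrite !nth_back1//; case: ltnP => h; rewrite !nth_scale// mulrBr.
Qed.

Lemma branch_scale c k : 0 < c -> branch (scale_tuple c k) = branch k.
Proof. by move=> c0; rewrite /branch !nth_scale// ltr_pM2l. Qed.

Lemma energy_scale c n a b k : 0 < c ->
  energy n (a, b, scale_tuple c k) = energy n (a, b, k).
Proof.
move=> c0; elim: n a b k => [|n IH] a b k; first by rewrite /energy !big_ord0.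
by rewrite !energyS /gain_of /pull /= branch_scale// back_scale IH.
Qed.

Lemma positive_scale c k : 0 < c -> positive (scale_tuple c k) <-> positive k.
Proof.
by move=> c0; split => k0 i im; have := k0 i im; rewrite nth_scale// pmulr_rgt0.
Qed.

(** The linear map by which the extended map acts on the branch [w]; unlike the
    extended map it is defined everywhere. *)
Definition joint_step w x : point := (step_l w x.1, step_k w x.2).

Lemma lebn2_joint_step w A : measurable A -> lebn2 (joint_step w @^-1` A) = lebn2 A.
Proof.
move=> mA; apply: (product_measure_preimage (f := step_l w) (g := step_k w)) => //.
- exact: measurable_step_l.
- exact: measurable_step_k.
- by move=> B mB; exact: lebn_step_l.
- by move=> B mB; exact: lebn_step_k.
Qed.

Lemma measurable_joint_step w : measurable_fun setT (joint_step w).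
Proof.
apply: measurable_fun_pair; apply: measurableT_comp => //.
  exact: measurable_step_l.
exact: measurable_step_k.
Qed.

Definition branch_set w : set point := [set x : point | x.2`_0 != x.2`_m /\ branch x.2 = w].

Lemma measurable_snd_nth i : measurable_fun setT (fun x : point => x.2`_i).
Proof. exact: (measurableT_comp (measurable_nth _)). Qed.

Lemma branch_setE w : branch_set w =
  if w then [set x : point | x.2`_m < x.2`_0] else [set x : point | x.2`_0 < x.2`_m].
Proof.
case: w; apply/seteqP; split => x; rewrite /branch_set /branch /=.
- by case.
- by move=> h; rewrite h gt_eqF.
- by move=> [ne] /negbT; rewrite -leNgt le_eqVlt (negbTE ne).
- by move=> h; rewrite lt_eqF//; split => //; apply/negbTE; rewrite -leNgt ltW.
Qed.

Lemma measurable_branch_set w : measurable (branch_set w).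
Proof.
by rewrite branch_setE; case: w; apply: measurable_lt; exact: measurable_snd_nth.
Qed.

Lemma lebn2_tie : lebn2 [set x : point | x.2`_0 = x.2`_m] = 0%E.
Proof.
rewrite [LHS]product_measure_sections integral0_eq// => l _.
exact: lebn_tie.
Qed.

Lemma measurable_tie : measurable [set x : point | x.2`_0 = x.2`_m].
Proof. by apply: measurable_eq_fun; exact: measurable_snd_nth. Qed.

Lemma lebn2U (A B : set point) : measurable A -> measurable B -> A `&` B = set0 ->
  lebn2 (A `|` B) = (lebn2 A + lebn2 B)%E.
Proof. exact: measureU. Qed.

(** The images of the two branches fill the cone up to a null set. *)
Lemma lebn2_split A : measurable A ->
  lebn2 A = (lebn2 (A `&` branch_set true) + lebn2 (A `&` branch_set false))%E.
Proof.
move=> mA; have mAb w : measurable (A `&` branch_set w).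
  by apply: measurableI => //; exact: measurable_branch_set.
have mt := measurableI _ _ mA measurable_tie.
set tie := [set x : point | x.2`_0 = x.2`_m] in mt.
have AE : A = (A `&` branch_set true `|` A `&` branch_set false) `|` (A `&` tie).
  rewrite -!setIUr [X in _ `&` X](_ : _ = setT) ?setIT//.
  rewrite -subTset => x _; have [xx|xx] := eqVneq x.2`_0 x.2`_m; first by right.
  by left; split => //; case h : (branch x.2); [left|right].
transitivity (lebn2
  ((A `&` branch_set true `|` A `&` branch_set false) `|` (A `&` tie))).
  by rewrite -AE.
rewrite measureU0//.
- rewrite measureU//.
  apply/seteqP; split => // x [[_ [_ h]] [_ [_]]]; by rewrite h.
- by apply: measurableU.
- apply/eqP; rewrite eq_le measure_ge0 andbT -[leRHS]lebn2_tie.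
  apply: le_measure; rewrite ?inE//.
  exact: measurable_tie.
Qed.

Lemma joint_step_side w x : Dom_T (step_l w x.1) -> Dom_T x.1 /\ side x.1 = w.
Proof.
move=> D; have [D' _] := Dom_T_dual m0 w D; rewrite step_lK// in D'.
have [_] := generic_dual m0 w D.1; rewrite step_lK//.
Qed.

Lemma rescale_joint_step w x : rescale N (joint_step w x) = joint_step w (rescale N x).
Proof. by rewrite /rescale /joint_step /= dot_step// step_k_scale. Qed.

(** The extended map commutes with rescaling, so it acts on cones, and there it
    is [joint_step w] above the points with branch [w]. *)
Lemma cone_preimage A : cone N (Dom_eT N `&` ext_triangle_map @^-1` A) =
  joint_step true @^-1` (cone N A `&` branch_set true) `|`
  joint_step false @^-1` (cone N A `&` branch_set false).
Proof.
apply/seteqP; split => x.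
  move=> [/= h [[_ Ax] Dx]].
  have c0 : 0 < N / dot x.1 x.2 by rewrite divr_gt0//; case/andP: h.
  have := Dom_eT_map m0 Dx; have := Dom_eT_map_tie m0 Dx.
  have /Dom_eTP[/= Dx1 /(positive_scale _ c0) kx _] := Dx.
  have gx := Dom_T_generic m0 Dx1.
  move: Ax; rewrite /= ext_triangle_map_generic// -/(joint_step (side x.1) (rescale N x)) -rescale_joint_step.
  set w := side x.1 => Aw tie DL.
  suff H : (cone N A `&` branch_set w) (joint_step w x) by case: (w) H => H; [left|right].
  split; first by split => //=; rewrite dot_step.
  by split; [exact: step_tie|exact: branch_step].
suff H w : (cone N A `&` branch_set w) (joint_step w x) ->
    cone N (Dom_eT N `&` ext_triangle_map @^-1` A) x by move=> [|]; exact: H.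
move=> [[/=]]; rewrite dot_step// => h [AL DL] [/= tie bw].
have c0 : 0 < N / dot x.1 x.2 by rewrite divr_gt0//; case/andP: h.
have /Dom_eTP[/= DL1] := DL; rewrite dot_step// => /(positive_scale _ c0) kL dL.
have [Dx1 sx] := joint_step_side DL1.
have kx : positive x.2.
  by have := positive_back m0 kL tie; rewrite bw step_kK.
have Dx : Dom_eT N (rescale N x).
  by apply/Dom_eTP; split => //=; [exact/positive_scale|move: dL; rewrite !dot_scale dot_step].
split => //; split => //; split => //=.
rewrite ext_triangle_map_generic; last exact: Dom_T_generic.
by rewrite /= sx -[X in A X]/(joint_step w (rescale N x)) -rescale_joint_step.
Qed.

Lemma measurable_ext_preimage (A : set point) : measurable A ->
  measurable (Dom_eT N `&` ext_triangle_map @^-1` A).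
Proof.
move=> mA; apply: measurableI; first exact: measurable_Dom_eT.
by apply: measurable_preimage => //; exact: measurable_ext_triangle_map.
Qed.

(** Each of the two preimages of [cone_preimage] has the measure of the
    corresponding part of the cone. *)
Lemma mu_eT_invariant (A : set point) : measurable A ->
  mu_eT N (Dom_eT N `&` ext_triangle_map @^-1` A) = mu_eT N A.
Proof.
move=> mA; have mC := measurable_cone N mA.
have mCb w : measurable (cone N A `&` branch_set w).
  by apply: measurableI => //; exact: measurable_branch_set.
apply: (mu_eT_eq N0 (measurable_ext_preimage mA) mA).
rewrite cone_preimage lebn2U.
- by rewrite (lebn2_split mC) (lebn2_joint_step true (mCb true)) (lebn2_joint_step false (mCb false)).
- by apply: measurable_preimage => //; exact: measurable_joint_step.
- by apply: measurable_preimage => //; exact: measurable_joint_step.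
apply/seteqP; split => // x [[[_ [_ /Dom_eTP[/= D1 _ _]]] _] [[_ [_ /Dom_eTP[/= D2 _ _]]] _]].
have [_ s1] := @joint_step_side true x D1; have [_ s2] := @joint_step_side false x D2.
by rewrite s1 in s2.
Qed.

Definition unbounded_points c : set point :=
  Dom_eT N `&` \bigcap_(M : nat) \bigcup_n
    [set x : point | M%:R <= energy n (x.1, basis c, x.2)].

Lemma measurable_unbounded_points c : measurable (unbounded_points c).
Proof.
apply: measurableI; first exact: measurable_Dom_eT.
apply: bigcapT_measurable => M; apply: bigcupT_measurable => n.
apply: measurable_le => //; apply: (measurableT_comp (measurable_energy n)).
by apply: measurable_fun_pair => //; apply: measurable_fun_pair.
Qed.

(** The energy is constant on rays, so the cone over the exceptional points
    consists of exceptional vectors [k], which form a null set for every [l]. *)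
Lemma mu_eT_unbounded c : mu_eT N (unbounded_points c) = 0%E.
Proof.
apply: (mu_eT_0 N0); first exact: measurable_unbounded_points.
rewrite [LHS]product_measure_sections integral0_eq// => l _.
have [Dl|Dl] := pselect (Dom_T l); last first.
  rewrite (_ : [set y | _] = set0) ?measure0//.
  by apply/seteqP; split => k // [_ [_ /Dom_eTP[]]].
apply: (subset_measure0 _ _ _ (lebn_unbounded_energy m0 (basis c) N0 (triangle_positive Dl.1))).
- exact: (measurable_xslice l (measurable_cone N (measurable_unbounded_points c))).
- exact: measurable_unbounded_energy.
move=> k [/= /andP[d0 dN] [[_ H] /Dom_eTP[_ /= kx _]]].
have c0 : 0 < N / dot l k by rewrite divr_gt0.
rewrite unbounded_energyE => M _; have [n _ /= Mn] := H M I.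
exists n => //; split => //; first by move: kx; rewrite positive_scale.
by move: Mn; rewrite energy_scale.
Qed.

(** The measure [nu] is infinite and invariant under dilations of [l]; bounds
    on [l] from both sides make the cone bounded. *)
Definition level j : set vec :=
  triangle `&` [set l : vec | j.+1%:R^-1 < l`_m /\ l`_0 < j.+1%:R].

Lemma measurable_level j : measurable (level j).
Proof.
apply: measurableI; first exact: measurable_triangle.
rewrite (_ : [set _ | _] = [set l : vec | j.+1%:R^-1 < l`_m] `&` [set l | l`_0 < j.+1%:R])//.
by apply: measurableI; apply: measurable_lt => //; exact: measurable_nth.
Qed.

Lemma level_cover l : triangle l -> exists j, level j l.
Proof.
move=> tl; have lm := triangle_positive tl (leqnn m).
have l0 := triangle_positive tl (leq0n m).
pose j := maxn (Num.bound (l`_m)^-1) (Num.bound l`_0).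
exists j; split => //; split.
  rewrite invf_plt ?posrE//; apply: (lt_le_trans (archi_boundP _)).
    by rewrite invr_ge0 ltW.
  by rewrite ler_nat leqW// leq_maxl.
apply: (lt_le_trans (archi_boundP _)); first exact: ltW.
by rewrite ler_nat leqW// leq_maxr.
Qed.

Lemma nu_level_fin j : (nu_T N (level j) < +oo)%E.
Proof.
have mL : measurable (fst @^-1` level j : set point).
  by apply: measurable_preimage => //; exact: measurable_level.
apply: (mu_eT_fin N0) => //.
pose J : vec := [tuple j.+1%:R | i < m.+1].
pose K : vec := [tuple N * j.+1%:R | i < m.+1].
have JE i : tnth J i = j.+1%:R by rewrite tnth_mktuple.
have KE i : tnth K i = N * j.+1%:R by rewrite tnth_mktuple.
have J0 i : 0 < tnth J i by rewrite JE.
have K0 i : 0 < tnth K i by rewrite KE mulr_gt0.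
apply: (@le_lt_trans _ _ (lebn2 (box J `*` box K))).
  apply: le_measure; rewrite ?inE.
  - exact: measurable_cone.
  - by apply: measurableX; exact: measurable_box.
  move=> x [/andP[d0 dN] [[tl [/= lj jl]] /Dom_eTP[_ kx _]]].
  have c0 : 0 < N / dot x.1 x.2 by rewrite divr_gt0.
  move: kx => /(positive_scale _ c0) kx; have lx := triangle_positive tl.
  split => i; have im : (i <= m)%N by rewrite -ltnS.
    rewrite (tnth_nth 0) JE lx//= (le_lt_trans _ jl)//.
    by rewrite triangle_le.
  rewrite (tnth_nth 0) KE kx//=.
  have : x.1`_i * x.2`_i < N.
    rewrite (le_lt_trans _ dN)// /dot (bigD1 i)//= lerDl sumr_ge0// => p _.
    by rewrite mulr_ge0// ltW// ?lx ?kx// -ltnS.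
  rewrite mulrC -ltr_pdivlMr; last exact: lx.
  move=> h; rewrite (lt_le_trans h)// ler_pM2l//.
  rewrite -[leRHS]invrK lef_pV2 ?posrE ?invr_gt0// ?lx//.
  by rewrite (le_trans (ltW lj))// triangle_le// im leqnn.
rewrite /lebn2 [X in (X < _)%E]product_measure1E; [|exact: measurable_box..].
by rewrite [X in (X * _ < _)%E]lebn_box// [X in (_ * X < _)%E]lebn_box// -EFinM ltry.
Qed.

End invariance.

(** * Almost everywhere inverses *)
Local Notation dom X := (@ms_dom _ X).

Section ae.
Context {R : realType}.
Implicit Types X Y Z : measure_space R.

Lemma mu_eq_ae X (A B : set X) : measurable A -> measurable B ->
  A `<=` dom X -> B `<=` dom X -> ms_eq_ae A B -> ms_mu X A = ms_mu X B.
Proof.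
move=> mA mB AX BX [M [mM M0 HM]].
have half (C D : set X) : measurable C -> measurable D -> C `\` D `<=` M ->
    (ms_mu X C <= ms_mu X D)%E.
  move=> mC mD CDM; apply: (@le_trans _ _ (ms_mu X (D `|` M))).
    apply: le_measure; rewrite ?inE//; first exact: measurableU.
    by move=> x Cx; have [Dx|Dx] := pselect (D x); [left|right; exact: CDM].
  by apply: (le_trans (measureU2 _ _ _)) => //; rewrite [X in (_ + X <= _)%E]M0 adde0.
apply/eqP; rewrite eq_le !half// => x [h1 h2]; apply: HM => /= H.
  by apply: h2; exact: (H (BX _ h1)).2.
by apply: h2; exact: (H (AX _ h1)).1.
Qed.

Lemma ms_ae_all X (P : X -> Prop) : (forall x, dom X x -> P x) -> ms_ae P.
Proof. by move=> H; apply: aeW => x; exact: H. Qed.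

Lemma ms_aeS X (P Q : X -> Prop) : (forall x, dom X x -> P x -> Q x) -> ms_ae P -> ms_ae Q.
Proof. by move=> H; rewrite /ms_ae; apply: filterS => x Px Xx; apply: H => //; exact: Px. Qed.

Lemma ms_aeI X (P Q : X -> Prop) : ms_ae P -> ms_ae Q -> ms_ae (fun x => P x /\ Q x).
Proof. move=> hP hQ; move: hP hQ; rewrite /ms_ae; apply: filterS2 => x Px Qx Xx.
by split; [exact: Px|exact: Qx].
Qed.

Lemma ms_ae_nat X (P : nat -> X -> Prop) : (forall n, ms_ae (P n)) ->
  ms_ae (fun x => forall n, P n x).
Proof. by move=> H; move/ae_foralln : H; rewrite /ms_ae; apply: filterS => x Px Xx n; exact: Px. Qed.

Lemma mp_measurable X Y (f : X -> Y) B : measure_preserving f -> measurable B ->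
  measurable (dom X `&` f @^-1` B).
Proof. by move=> [_ mf _] mB; apply: mf => //; exact: measurable_ms_dom. Qed.

Lemma mp_ae X Y (f : X -> Y) (P : Y -> Prop) : measure_preserving f ->
  ms_ae P -> ms_ae (fun x => P (f x)).
Proof.
move=> mpf [M [mM M0 HM]]; have [fXY mf pf] := mpf.
have mMY : measurable (M `&` dom Y) by apply: measurableI => //; exact: measurable_ms_dom.
exists (dom X `&` f @^-1` (M `&` dom Y)); split.
- exact: mp_measurable.
- rewrite pf; last by split => // ? [].
  by apply/eqP; rewrite eq_le measure_ge0 andbT -[leRHS]M0 le_measure ?inE// => ? [].
move=> x /= h; have Xx : dom X x by apply: contrapT => nXx; apply: h.
split => //; split; last exact: fXY.
by apply: HM => h'; apply: h => _; apply: h'; exact: fXY.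
Qed.

Lemma mp_comp X Y Z (f : X -> Y) (g : Y -> Z) :
  measure_preserving f -> measure_preserving g -> measure_preserving (g \o f).
Proof.
move=> mpf mpg; have [fXY mf pf] := mpf; have [gYZ mg pg] := mpg.
have E B : dom X `&` (g \o f) @^-1` B = dom X `&` f @^-1` (dom Y `&` g @^-1` B).
  by apply/seteqP; split => x [Xx Bx]; split => //; [split => //; exact: fXY|case: Bx].
split.
- by move=> x Xx; apply: gYZ; exact: fXY.
- by move=> _ B mB; rewrite E; apply: mp_measurable => //; exact: mp_measurable.
move=> B [mB BZ]; rewrite E pf ?pg//; split; last by move=> ? [].
exact: mp_measurable.
Qed.

Lemma mp_iter X (f : X -> X) n : measure_preserving f -> measure_preserving (iter n f).
Proof.
move=> mpf; elim: n => [|n IH].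
  split => //; first exact: measurable_id.
  move=> B [mB BX]; congr (ms_mu X _); apply/seteqP.
  by split => x; [case|move=> Bx; split => //; exact: BX].
exact: (mp_comp IH mpf).
Qed.

(** Let [E] be the set where [F] is injective.  The complement of [F @` E] is null
    because its preimage misses [E], and off this null set [F] is inverted by
    choice; that measurable subsets of [E] have measurable images is what makes
    the inverse measurable. *)
Lemma one_to_one_inverse X (F : X -> X) : measure_preserving F -> one_to_one F ->
  exists G : X -> X, [/\ measure_preserving G, ms_ae (fun x => F (G x) = x)
    & ms_ae (fun x => G (F x) = x)].
Proof.
move=> mpF [E [[mE EX] nE] [injE imE]]; have [FX mF pF] := mpF.
pose P y := exists x, E x /\ F x = y.
pose G y := if pselect (P y) is left h then projT1 (cid h) else y.
have GP y : P y -> E (G y) /\ F (G y) = y.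
  by rewrite /G; case: pselect => // h _; case: (cid h).
have GN y : ~ P y -> G y = y by rewrite /G; case: pselect.
have GF x : E x -> G (F x) = x.
  move=> Ex; have [|EG FG] := GP (F x); first by exists x.
  by apply: injE => //; apply/mem_set.
have mFE : measurable (F @` E) by exact: imE.
have FEX : F @` E `<=` dom X by move=> _ [x Ex <-]; apply: FX; exact: EX.
have PE y : (F @` E) y <-> P y.
  by split => [[x Ex <-]|[x [Ex <-]]]; exists x.
have aeE : ms_ae E.
  case: nE => M [mM M0 HM]; exists M; split => // x /= h; apply: HM.
  by split; [apply: contrapT => h'; apply: h|move=> Ex; apply: h].
have aeFE : ms_ae (F @` E).
  exists (dom X `\` F @` E); split.
  - by apply: measurableD => //; exact: measurable_ms_dom.
  - have mD : measurable (dom X `\` F @` E) by apply: measurableD => //; exact: measurable_ms_dom.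
    rewrite -pF; last by split => // ? [].
    rewrite (_ : 0%E = ms_mu X set0); last by rewrite measure0.
    apply: mu_eq_ae => //; first exact: mp_measurable.
    + rewrite /ms_eq_ae; move: aeE; apply: ms_aeS => x Xx Ex; split => // -[_ [_]]; apply.
      by exists x.
  - by move=> x /= h; split; [apply: contrapT => h'; apply: h|move=> Ex; apply: h].
have mG B : measurable B -> measurable (dom X `&` G @^-1` B).
  move=> mB.
  rewrite (_ : _ `&` _ = dom X `&` ((F @` (B `&` E)) `|` (B `\` F @` E))).
    apply: measurableI; first exact: measurable_ms_dom.
    apply: measurableU; last exact: measurableD.
    by apply: imE; [exact: measurableI|move=> ? []].
  apply/seteqP; split => y [Xy H]; split => //.
    have [Py|Py] := pselect (P y).
      left; exists (G y); last by have [] := GP _ Py.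
      by split => //; have [] := GP _ Py.
    by right; split; [move: H; rewrite /= GN|rewrite PE].
  case: H => [[x [Bx Ex] <-]|[By /PE Py]]; first by rewrite /= GF.
  by rewrite /= GN.
exists G; split.
- split.
  + move=> y Xy; have [Py|Py] := pselect (P y); last by rewrite GN.
    by apply: EX; have [] := GP _ Py.
  + by move=> _; exact: mG.
  + move=> B [mB BX].
    have mBE : measurable (F @` (B `&` E)).
      by apply: imE; [exact: measurableI|move=> ? []].
    have BEX : F @` (B `&` E) `<=` dom X.
      by move=> _ [x [Bx Ex] <-]; apply: FX; exact: EX.
    have mGB := mG _ mB.
    transitivity (ms_mu X (F @` (B `&` E))).
      apply: mu_eq_ae => //.
      rewrite /ms_eq_ae; move: aeFE; apply: ms_aeS => y Xy [x Ex xy]; rewrite -{}xy in Xy *; split.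
        by move=> [_]; rewrite /= GF// => Bx; exists x.
      by move=> [z [Bz Ez] <-]; split; rewrite /= ?GF//; apply: FX; exact: EX.
    rewrite -pF//; apply: mu_eq_ae => //; first exact: mp_measurable.
    rewrite /ms_eq_ae; move: aeE; apply: ms_aeS => x Xx Ex.
    split; last by move=> Bx; split => //; exists x.
    move=> [_ [z [Bz Ez] e]].
    by rewrite -(injE z x)//; apply/mem_set.
- by move: aeFE; apply: ms_aeS => y Xy /PE /GP[].
- by move: aeE; apply: ms_aeS => x Xx Ex; exact: GF.
Qed.

End ae.

(** * Histories of invertible coverings *)
Section histories.
Context {R : realType}.
Variable Y : measure_space R.

(** Finite products of measurable sets: a class that is stable under
    intersection, so a measure on paths is determined by its values there. *)
Definition cylinder (n : nat) (B : nat -> set Y) : set (nat -> Y) :=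
  [set omega | forall i, (i <= n)%N -> B i (omega i)].

Definition cylinders : set (set (nat -> Y)) :=
  [set C | exists n B, (forall i, measurable (B i)) /\ C = cylinder n B].

(** The space of sequences with the product sigma-algebra. *)
Definition paths := g_sigma_algebraType cylinders.

Lemma cylinders_setI : setI_closed cylinders.
Proof.
move=> _ _ [n1 [B1 [mB1 ->]]] [n2 [B2 [mB2 ->]]].
exists (maxn n1 n2), (fun i => (if (i <= n1)%N then B1 i else setT) `&`
  (if (i <= n2)%N then B2 i else setT)); split.
  by move=> i; apply: measurableI; case: ifP.
apply/seteqP; split => w.
  by move=> [h1 h2] i _; split; case: ifP => // ?; [exact: h1|exact: h2].
move=> H; split => i ii; have [|] := H i.
- by rewrite (leq_trans ii)// leq_maxl.
- by rewrite ii.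
- by rewrite (leq_trans ii)// leq_maxr.
- by rewrite ii.
Qed.

Lemma measurable_coordinate n : measurable_fun setT (fun w : paths => w n).
Proof.
move=> _ B mB; rewrite setTI; apply: sub_sigma_algebra.
exists n, (fun i => if (i == n)%N then B else setT); split.
  by move=> i; case: ifP.
apply/seteqP; split => w /=.
  by move=> Bw i _; case: ifP => // /eqP ->.
by move/(_ n (leqnn _)); rewrite eqxx.
Qed.

Lemma measurable_to_paths d (T : measurableType d) (D : set T) (h : T -> paths) :
  measurable D -> (forall n, measurable_fun D (fun x => h x n)) -> measurable_fun D h.
Proof.
move=> mD H; apply: (@measurability _ _ T paths D h cylinders) => // _ [C [n [B [mB ->]]] <-].
rewrite (_ : _ `&` _ = \bigcap_i (D `&`
    (if (i <= n)%N then (fun x => h x i) @^-1` B i else setT))).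
  apply: bigcapT_measurable => i; case: ifP => // _; last by rewrite setIT.
  exact: H.
apply/seteqP; split => x.
  by move=> [Dx Hx] i _; split => //; case: ifP => // ii; exact: Hx.
move=> Hx; split; first by have [] := Hx 0%N I.
by move=> i ii; have [_] := Hx i I; rewrite ii.
Qed.

End histories.

Section patch.

Lemma measurable_patch d1 d2 (T1 : measurableType d1) (T2 : measurableType d2)
    (D : set T1) (f : T1 -> T2) (c : T2) : measurable D -> measurable_fun D f ->
  measurable_fun setT (fun x => if x \in D then f x else c).
Proof.
move=> mD mf; apply: measurable_fun_if => //.
- by apply: (@measurable_mem _ _ _ _ id).
- rewrite setTI (_ : _ @^-1` _ = D)//.
  by apply/seteqP; split => x /=; [move/set_mem|move/mem_set].
Qed.

End patch.

Section law.
Context {R : realType}.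
Variables (Y : measure_space R) (S : Y -> Y).
Hypothesis mpS : measure_preserving S.

Definition history (X : measure_space R) (psi : X -> Y) (G : X -> X) (x : X) : paths Y :=
  fun n => psi (iter n G x).

(** An invertible covering with a chosen inverse [G]. *)
Definition inverse_cover (X : measure_space R) (F G : X -> X) (psi : X -> Y) : Prop :=
  [/\ measure_preserving G, measure_preserving psi,
      ms_ae (fun x => psi (F x) = S (psi x)) & ms_ae (fun x => F (G x) = x)].

Lemma measurable_history X F G psi : @inverse_cover X F G psi ->
  measurable_fun (dom X) (history psi G).
Proof.
move=> [mpG mppsi _ _]; apply: measurable_to_paths; first exact: measurable_ms_dom.
by move=> n; have [_ + _] := mp_comp (mp_iter n mpG) mppsi.
Qed.

Lemma history_ae X F G psi : @inverse_cover X F G psi ->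
  ms_ae (fun x => forall n, history psi G x n = S (history psi G x n.+1)).
Proof.
move=> [mpG mppsi semi FG]; apply: ms_ae_nat => n.
have h1 := mp_ae (mp_iter n.+1 mpG) semi.
have h2 := mp_ae (mp_iter n mpG) FG.
move: (ms_aeI h1 h2); apply: ms_aeS => x Xx [/= e1 e2].
by rewrite /history /= -e1 e2.
Qed.

(** The entry [n] of a history determines the entries before it, and its law is
    the measure of the base. *)
Lemma cylinder_law X F G psi n B : @inverse_cover X F G psi ->
  (forall i, measurable (B i)) ->
  ms_mu X (dom X `&` history psi G @^-1` cylinder n B) =
  ms_mu Y (dom Y `&` [set y | forall i, (i <= n)%N -> B i (iter (n - i) S y)]).
Proof.
move=> cov mB; have [mpG mppsi _ _] := cov.
set D := dom Y `&` _.
have mD : measurable D.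
  rewrite (_ : D = dom Y `&` \bigcap_i (dom Y `&`
      (if (i <= n)%N then iter (n - i) S @^-1` B i else setT))).
    apply: measurableI; first exact: measurable_ms_dom.
    apply: bigcapT_measurable => i; case: ifP => _.
      by apply: mp_measurable => //; exact: mp_iter.
    by rewrite setIT; exact: measurable_ms_dom.
  apply/seteqP; split => y [Yy h]; split => //.
    by move=> i _; split => //; case: ifP => // ii; exact: h.
  by move=> i ii; have [_] := h i I; rewrite ii.
have [_ _ <-] := mp_comp (mp_iter n mpG) mppsi; last by split => // ? [].
have mC : measurable (dom X `&` history psi G @^-1` cylinder n B).
  apply: (measurable_history cov); first exact: measurable_ms_dom.
  by apply: sub_sigma_algebra; exists n, B.
apply: mu_eq_ae => //.
  by apply: mp_measurable => //; exact: mp_comp (mp_iter n mpG) mppsi.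
have [psiXY _ _] := mppsi; have [GX _ _] := mp_iter n mpG.
move: (history_ae cov); rewrite /ms_eq_ae; apply: ms_aeS => x Xx hx.
have H' j : forall i, (i <= n)%N -> (n - i)%N = j ->
    history psi G x i = iter j S (history psi G x n).
  elim: j => [|j IH] i ii ni; first by rewrite (_ : i = n)//; lia.
  by rewrite hx (IH i.+1) ?iterS//; lia.
have H i ii := H' _ i ii erefl.
split => -[_ h]; split => //.
  split; first by apply: psiXY; exact: GX.
  by move=> i ii; have := h i ii; rewrite H.
by move=> i ii; rewrite H//; exact: h.2.
Qed.

Variable level : nat -> set Y.
Hypothesis mlevel : forall j, measurable (level j).
Hypothesis cover_level : dom Y `<=` \bigcup_j level j.
Hypothesis fin_level : forall j, (ms_mu Y (dom Y `&` level j) < +oo)%E.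

Section law_measure.
Variables (X : measure_space R) (F G : X -> X) (psi : X -> Y).
Hypothesis cov : inverse_cover F G psi.

Let patched_history (x : X) : paths Y := if x \in dom X then history psi G x else point.

Let m_patched : measurable_fun setT patched_history.
Proof.
apply: measurable_patch; first exact: measurable_ms_dom.
exact: measurable_history cov.
Qed.

Lemma law_as_measure : exists mu : {measure set (paths Y) -> \bar R},
  forall C, mu C = ms_mu X (dom X `&` history psi G @^-1` C).
Proof.
pose nu := mrestr (ms_mu X) (measurable_ms_dom X).
have [mu muE] : exists mu : {measure set (paths Y) -> \bar R},
    forall C, mu C = pushforward nu patched_history C.
  by unshelve eexists (pushforward nu patched_history); [exact: m_patched|].
exists mu => C; rewrite muE /pushforward /nu /mrestr.
congr (ms_mu X _); rewrite setIC; apply/seteqP.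
by split => x [Xx]; split => //; move: b; rewrite /= /patched_history mem_set.
Qed.

End law_measure.

(** By [cylinder_law] the two laws agree on cylinders.  The measures may be
    infinite, and the cylinders over the [level j] provide the exhaustion by
    sets of finite measure. *)
Lemma history_law X1 F1 G1 psi1 X2 F2 G2 psi2 (C : set (paths Y)) :
  @inverse_cover X1 F1 G1 psi1 -> @inverse_cover X2 F2 G2 psi2 -> measurable C ->
  ms_mu X1 (dom X1 `&` history psi1 G1 @^-1` C) =
  ms_mu X2 (dom X2 `&` history psi2 G2 @^-1` C).
Proof.
move=> cov1 cov2 mC.
have [mu1 E1] := law_as_measure cov1; have [mu2 E2] := law_as_measure cov2.
rewrite -E1 -E2.
pose g j : set (paths Y) := cylinder 0 (fun=> level j `|` ~` dom Y).
have mg j : measurable (level j `|` ~` dom Y).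
  by apply: measurableU => //; apply: measurableC; exact: measurable_ms_dom.
apply: (@measure_unique _ R (paths Y) (@cylinders _ Y) g) => //.
- exact: cylinders_setI.
- by move=> j; exists 0%N, (fun=> level j `|` ~` dom Y).
- rewrite -subTset => w _.
  have [/cover_level[j _ h]|h] := pselect (dom Y (w 0%N)).
    by exists j => // i; rewrite leqn0 => /eqP ->; left.
  by exists 0%N => // i; rewrite leqn0 => /eqP ->; right.
- move=> _ [n [B [mB ->]]]; rewrite E1 E2.
  by rewrite (cylinder_law _ cov1 mB) (cylinder_law _ cov2 mB).
move=> j; rewrite E1 (cylinder_law _ cov1) //.
rewrite (_ : dom Y `&` _ = dom Y `&` level j)//.
apply/seteqP; split => y [Yy h]; split => //.
  by have [] := h 0%N (leqnn _).
by move=> i; rewrite leqn0 => /eqP ->; left.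
Qed.

(** This is how statements about one covering become statements about all. *)
Lemma history_ae_transfer X1 F1 G1 psi1 X2 F2 G2 psi2 (C : set (paths Y)) :
  @inverse_cover X1 F1 G1 psi1 -> @inverse_cover X2 F2 G2 psi2 -> measurable C ->
  ms_ae (fun x => C (history psi1 G1 x)) -> ms_ae (fun x => C (history psi2 G2 x)).
Proof.
move=> cov1 cov2 mC aeC.
have mCC : measurable (~` C) by exact: measurableC.
have mH X F G psi (cov : @inverse_cover X F G psi) :
    measurable (dom X `&` history psi G @^-1` (~` C)).
  by apply: (measurable_history cov) => //; exact: measurable_ms_dom.
exists (dom X2 `&` history psi2 G2 @^-1` (~` C)); split.
- exact: mH cov2.
- rewrite -(history_law cov1 cov2)//; apply/eqP; rewrite eq_le measure_ge0 andbT.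
  have [M [mM M0 HM]] := aeC; rewrite -[leRHS]M0; apply: le_measure; rewrite ?inE//.
    exact: mH cov1.
  by move=> x [Xx nC]; apply: HM => /= h; apply: nC; exact: h.
- move=> x /= h; split; first by apply: contrapT => h'; apply: h.
  by move=> Cx; apply: h.
Qed.

End law.

(** * A criterion for natural extensions *)
Section criterion.
Context {R : realType}.
Variables (X Y : measure_space R) (S : Y -> Y) (F : X -> X) (psi : X -> Y).
Hypothesis mpS : measure_preserving S.
Hypothesis mpF : measure_preserving F.
Hypothesis mppsi : measure_preserving psi.
Hypothesis injF : {in dom X &, injective F}.
Hypothesis imF : forall A, ms_measurable A -> measurable (F @` A).
Hypothesis semi : forall x, dom X x -> psi (F x) = S (psi x).
Hypothesis surj : dom Y `<=` psi @` dom X.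
Variable level : nat -> set Y.
Hypothesis mlevel : forall j, measurable (level j).
Hypothesis cover_level : dom Y `<=` \bigcup_j level j.
Hypothesis fin_level : forall j, (ms_mu Y (dom Y `&` level j) < +oo)%E.
Hypothesis diagX : measurable [set z : X * X | z.1 = z.2].
Hypothesis diagY : measurable [set z : Y * Y | z.1 = z.2].
Variable rebuild : paths Y -> X.
Hypothesis mrebuild : measurable_fun setT rebuild.
Hypothesis rebuildP : ms_ae (fun x : X => forall z : nat -> X, z 0%N = x ->
  (forall n, dom X (z n)) -> (forall n, F (z n.+1) = z n) ->
  rebuild (fun n => psi (z n)) = x).

Let one_to_oneF : one_to_one F.
Proof.
have mX := @measurable_ms_dom _ X.
exists (dom X); first by split; [split|rewrite setDv; exact: negligible_set0].
by split => // A mA AX; exact: imF.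
Qed.

Let cover : invertible_cover S F psi.
Proof.
split => //; last exact: ms_ae_all.
rewrite /onto (_ : _ `\` _ = set0); first exact: negligible_set0.
by apply/seteqP; split => y // [/surj].
Qed.

Let inverse_coverP (X' : measure_space R) (F' : X' -> X') (psi' : X' -> Y) :
  invertible_cover S F' psi' ->
  exists G, inverse_cover S F' G psi' /\ ms_ae (fun x => G (F' x) = x).
Proof.
move=> [mpF' inj' mppsi' _ semi'].
by have [G [mpG FG GF]] := one_to_one_inverse mpF' inj'; exists G.
Qed.

Let rebuild_history G : inverse_cover S F G psi ->
  ms_ae (fun x => rebuild (history psi G x) = x).
Proof.
move=> [mpG _ _ FG].
have orbit : ms_ae (fun x => forall n, F (iter n.+1 G x) = iter n G x).
  by apply: ms_ae_nat => n; exact: (mp_ae (mp_iter n mpG) FG).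
move: (ms_aeI orbit rebuildP); apply: ms_aeS => x Xx [hx /(_ (fun n => iter n G x))].
by apply => // n; have [GX _ _] := mp_iter n mpG; exact: GX.
Qed.

(** The coordinate [i] of the history is measurable, modulo null sets, with
    respect to the sets [F^i (psi^-1 B)]; so is the point itself, as a
    measurable function of its history. *)
Let forward_generatedP : forward_generated F psi.
Proof.
have [G [cov GF]] := inverse_coverP cover.
have [mpG _ _ FG] := cov.
set K := <<s dom X, forward_images F psi >>.
have mpsi B : measurable B -> measurable (dom X `&` psi @^-1` B).
  exact: mp_measurable.
have [psiXY _ _] := mppsi; have [FX _ _] := mpF.
split; last first.
  suff KM : K `<=` @ms_measurable _ X by move=> B /KM mB; exists B => //; exact: ms_ae_all.
  apply: smallest_sub.
    split.
    - by split => // ? [].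
    - move=> A [mA _]; split; last by move=> ? [].
      by apply: measurableD => //; exact: measurable_ms_dom.
    - move=> A mA; split; last by move=> x [n _]; exact: (mA n).2.
      by apply: bigcupT_measurable => n; exact: (mA n).1.
  move=> _ [k [B [[mB BY] ->]]]; elim: k => [|k [IH1 IH2]].
    by rewrite image_id; split; [exact: mpsi|move=> ? []].
  have -> : iter k.+1 F @` (dom X `&` psi @^-1` B) =
      F @` (iter k F @` (dom X `&` psi @^-1` B)).
    by rewrite -image_comp.
  split; first exact: imF.
  by move=> _ [x /IH2 Xx <-]; exact: FX.
pose good (C : set (paths Y)) := exists2 B, K B & ms_eq_ae B (history psi G @^-1` C).
have K0 : K set0 by exact: sigma_algebra0.
have good_sigma : sigma_algebra setT good.
  split.
  - by exists set0 => //; exact: ms_ae_all.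
  - move=> C [B KB HB]; exists (dom X `\` B); first exact: sigma_algebraCD.
    move: HB; rewrite /ms_eq_ae; apply: ms_aeS => x Xx [h1 h2].
    by split => [[_ nB]|[_ nC]]; [split => // /h2|split => // /h1].
  - move=> C HC; have /choice[B HB] : forall n, exists B,
        K B /\ ms_eq_ae B (history psi G @^-1` C n).
      by move=> n; have [B ? ?] := HC n; exists B.
    exists (\bigcup_n B n); first by apply: sigma_algebra_bigcup => n; exact: (HB n).1.
    have : ms_ae (fun x => forall n, B n x <-> C n (history psi G x)).
      by apply: ms_ae_nat => n; exact: (HB n).2.
    rewrite /ms_eq_ae; apply: ms_aeS => x Xx h.
    by split => -[n _ hn]; exists n => //; apply/h.
have good_coord i (B : set Y) : measurable B -> good [set w | B (w i)].
  move=> mB; exists (iter i F @` (dom X `&` psi @^-1` (B `&` dom Y))).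
    apply: sub_sigma_algebra; exists i, (B `&` dom Y); split => //.
    by split; [apply: measurableI => //; exact: measurable_ms_dom|move=> ? []].
  have orbit : ms_ae (fun x => forall n, F (iter n.+1 G x) = iter n G x).
    by apply: ms_ae_nat => n; exact: (mp_ae (mp_iter n mpG) FG).
  move: orbit; rewrite /ms_eq_ae; apply: ms_aeS => x Xx hx.
  have GX n : dom X (iter n G x) by have [h _ _] := mp_iter n mpG; exact: h.
  have FiG : iter i F (iter i G x) = x.
    by elim: i => [//|i IH]; rewrite iterSr hx.
  have injFi z z' : dom X z -> dom X z' -> iter i F z = iter i F z' -> z = z'.
    move: z z'; elim: i {FiG} => [//|i IH] z z' Xz Xz'; rewrite !iterSr => /IH h.
    by apply: injF; rewrite ?inE//; apply: h; exact: FX.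
  split.
    move=> [z [Xz [Bz _]] zx]; rewrite /= /history.
    by rewrite -(injFi z (iter i G x))// zx.
  move=> Bx; exists (iter i G x) => //; split => //; split => //.
  exact: psiXY.
have [goodT goodC goodU] := good_sigma.
(* A cylinder is the complement of a countable union of conditions on single
   coordinates; the coordinates beyond [n] contribute the empty set. *)
have good_all C : measurable C -> good C.
  apply: smallest_sub => // _ [n [B [mB ->]]].
  pose B' i := if (i <= n)%N then ~` B i else set0.
  have mB' i : measurable (B' i) by rewrite /B'; case: ifP => // _; exact: measurableC.
  rewrite (_ : cylinder n B = setT `\` \bigcup_i [set w | B' i (w i)]).
    by apply: (goodC); apply: goodU => i; exact: good_coord.
  apply/seteqP; split => w.
    by move=> h; split => // -[i _]; rewrite /= /B'; case: ifP => // ii; apply; exact: h.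
  move=> [_ h] i ii; apply: contrapT => nB; apply: h; exists i => //.
  by rewrite /= /B' ii.
move=> A [mA AX].
have [|B KB HB] := good_all (rebuild @^-1` A).
  by have := mrebuild measurableT mA; rewrite setTI.
exists B => //; move: (ms_aeI HB (rebuild_history cov)).
rewrite /ms_eq_ae; apply: ms_aeS => x Xx [h e].
by rewrite h /= e.
Qed.

(** Rebuild a point of [X] from the history in [X'].  That the result lies in
    the domain, projects correctly and intertwines the maps are measurable
    properties of a history, true of almost every history in [X], hence of
    almost every history in [X']. *)
Let factorization (X' : measure_space R) (F' : X' -> X') (psi' : X' -> Y) :
  invertible_cover S F' psi' ->
  exists phi : X' -> X, [/\ measure_preserving phi,
    ms_ae (fun x => phi (F' x) = F (phi x)) & ms_ae (fun x => psi (phi x) = psi' x)].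
Proof.
move=> cover'; have [G [cov GF]] := inverse_coverP cover.
have [G' [cov' GF']] := inverse_coverP cover'.
have [mpF' _ mppsi' _ semi'] := cover'.
have [mpG _ _ FG] := cov; have [mpG' _ _ FG'] := cov'.
have [FX _ _] := mpF; have [FX' _ _] := mpF'.
have transfer := history_ae_transfer mpS mlevel cover_level fin_level cov cov'.
have rb := rebuild_history cov.
have mdX := @measurable_ms_dom _ X; have mdY := @measurable_ms_dom _ Y.
(* The maps are measurable on the domains only; the constant continuations
   are measurable everywhere. *)
pose F0 x := if x \in dom X then F x else point.
pose S0 y := if y \in dom Y then S y else point.
pose psi0 x := if x \in dom X then psi x else point.
have mF0 : measurable_fun setT F0 by apply: measurable_patch => //; have [] := mpF.
have mS0 : measurable_fun setT S0 by apply: measurable_patch => //; have [] := mpS.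
have mpsi0 : measurable_fun setT psi0 by apply: measurable_patch => //; have [] := mppsi.
(* The history of the image of a point. *)
pose push (w : paths Y) : paths Y := fun n => if n is n'.+1 then w n' else S0 (w 0%N).
have mpush : measurable_fun setT push.
  apply: measurable_to_paths => // -[|n]; last exact: measurable_coordinate.
  by apply: (measurableT_comp mS0); exact: measurable_coordinate.
have push_history (X1 : measure_space R) (F1 G1 : X1 -> X1) psi1 : measure_preserving psi1 ->
    ms_ae (fun x => psi1 (F1 x) = S (psi1 x)) -> ms_ae (fun x => G1 (F1 x) = x) ->
    ms_ae (fun x => history psi1 G1 (F1 x) = push (history psi1 G1 x)).
  move=> [psi1XY _ _] h1 h2; move: (ms_aeI h1 h2); apply: ms_aeS => x Xx [e1 e2].
  apply/funext => -[|n]; rewrite /history /push.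
    by rewrite /= /S0 mem_set//; exact: psi1XY.
  by rewrite iterSr e2.
have C1 : ms_ae (fun x => dom X (rebuild (history psi' G' x))).
  apply: (transfer (rebuild @^-1` dom X)); first exact: measurable_preimage.
  by move: rb; apply: ms_aeS => x Xx /= ->.
have C2 : ms_ae (fun x => F0 (rebuild (history psi' G' x)) =
    rebuild (push (history psi' G' x))).
  apply: (transfer [set w | F0 (rebuild w) = rebuild (push w)]).
    apply: (@measurable_preimage _ _ _ _ (fun w => (F0 (rebuild w), rebuild (push w))) _ _ diagX).
    by apply: measurable_fun_pair;
      [exact: (measurableT_comp mF0)|exact: (measurableT_comp mrebuild)].
  have h1 := push_history X F G psi mppsi (ms_ae_all semi) GF.
  have h2 := mp_ae mpF rb.
  move: (ms_aeI rb (ms_aeI h1 h2)); apply: ms_aeS => x Xx [e0 [e1 e2]] /=.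
  by rewrite -e1 e2 e0 /F0 mem_set.
have C3 : ms_ae (fun x => psi0 (rebuild (history psi' G' x)) = psi' x).
  apply: (transfer [set w | psi0 (rebuild w) = w 0%N]).
    apply: (@measurable_preimage _ _ _ _
      (fun w : paths Y => (psi0 (rebuild w), w 0%N)) _ _ diagY).
    by apply: measurable_fun_pair;
      [exact: (measurableT_comp mpsi0)|exact: measurable_coordinate].
  by move: rb; apply: ms_aeS => x Xx /= ->; rewrite /psi0 mem_set.
(* On a null set the rebuilt point may leave the domain; it is sent to [x0]. *)
have [x0 Hx0] : exists x0, forall x', dom X' x' -> dom X x0.
  have [[x Xx]|nX] := pselect (exists x, dom X x); first by exists x.
  exists point => x' Xx'; exfalso; apply: nX.
  have [psiXY' _ _] := mppsi'.
  by have [x Xx _] := surj (psiXY' _ Xx'); exists x.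
pose clamp x := if x \in dom X then x else x0.
have mclamp : measurable_fun setT clamp by apply: measurable_patch => //; exact: measurable_id.
pose phi x := clamp (rebuild (history psi' G' x)).
have phiE : ms_ae (fun x => phi x = rebuild (history psi' G' x)).
  by move: C1; apply: ms_aeS => x Xx h; rewrite /phi /clamp mem_set.
have phiX x : dom X' x -> dom X (phi x).
  move=> Xx; rewrite /phi /clamp; case: ifPn => [/set_mem//|_].
  exact: Hx0 Xx.
have mphi : measurable_fun (dom X') phi.
  apply: (measurableT_comp mclamp); apply: (measurableT_comp mrebuild).
  exact: measurable_history cov'.
exists phi; split.
- split => //.
  move=> B [mB BX].
  have mrB : measurable (rebuild @^-1` B) by exact: measurable_preimage.
  have mB1 : measurable (dom X' `&` phi @^-1` B).
    by apply: mphi => //; exact: measurable_ms_dom.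
  have mB2 : measurable (dom X' `&` history psi' G' @^-1` (rebuild @^-1` B)).
    by apply: (measurable_history cov') => //; exact: measurable_ms_dom.
  transitivity (ms_mu X' (dom X' `&` history psi' G' @^-1` (rebuild @^-1` B))).
    apply: mu_eq_ae => //.
    move: phiE; rewrite /ms_eq_ae; apply: ms_aeS => x Xx e.
    by split => -[_ h]; split => //; move: h; rewrite /= e.
  rewrite (history_law mpS mlevel cover_level fin_level cov' cov)//.
  apply: mu_eq_ae => //.
    by apply: (measurable_history cov) => //; exact: measurable_ms_dom.
  move: rb; rewrite /ms_eq_ae; apply: ms_aeS => x Xx e.
  by split => [[_]|h]; [rewrite /= e|split => //; rewrite /= e].
- have h1 := push_history X' F' G' psi' mppsi' semi' GF'.
  move: (ms_aeI (ms_aeI C1 C2) (ms_aeI (ms_aeI phiE (mp_ae mpF' phiE)) h1)).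
  apply: ms_aeS => x Xx [[c1 c2] [[e1 e2] e3]].
  by rewrite e1 e2 e3 -c2 /F0 mem_set.
- move: (ms_aeI (ms_aeI C1 C3) phiE); apply: ms_aeS => x Xx [[c1 c3] e].
  by rewrite e -c3 /psi0 mem_set.
Qed.

(** An injective extension is the natural extension as soon as almost every
    point is a measurable function of the projection of its past.  The
    measurable diagonals serve to state equations between points as measurable
    properties of histories. *)
Lemma natural_extension_criterion : natural_extension X Y S F psi.
Proof.
split.
- exact: mpS.
- exact: cover.
- exact: forward_generatedP.
- exact: factorization.
Qed.

End criterion.

(** * The triangle map *)
Section final.
Context {R : realType} {m : nat}.
Local Notation vec := (m.+1.-tuple R).
Local Notation point := (vec * vec)%type.
Hypothesis m0 : (0 < m)%N.
Variable N : R.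
Hypothesis N0 : 0 < N.

Local Notation X := (space_eT m N).
Local Notation Y := (space_T m N).

Lemma mu_eT_dom (A B : set point) : Dom_eT N `&` A = Dom_eT N `&` B ->
  mu_eT N A = mu_eT N B.
Proof. by move=> AB; rewrite /mu_eT setIC AB setIC. Qed.

Lemma measurable_fst_preimage (B : set vec) : measurable B ->
  measurable (fst @^-1` B : set point).
Proof. exact: measurable_preimage. Qed.

Lemma fst_preserving : measure_preserving (fst : X -> Y).
Proof.
split.
- by move=> x /Dom_eTP[].
- exact: measurable_funTS.
move=> B [mB BY]; apply: mu_eT_dom.
by rewrite setIA setIid.
Qed.

Lemma ext_preserving : measure_preserving (ext_triangle_map : X -> X).
Proof.
split.
- by move=> x; exact: Dom_eT_map.
- by apply: measurable_funTS; exact: measurable_ext_triangle_map.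
by move=> B [mB BX]; exact: mu_eT_invariant.
Qed.

Lemma triangle_map_preserving : measure_preserving (triangle_map : Y -> Y).
Proof.
split.
- by move=> l; exact: Dom_T_map.
- by apply: measurable_funTS; exact: measurable_triangle_map.
move=> B [mB BY]; have mB' := measurable_fst_preimage mB.
transitivity (mu_eT N (Dom_eT N `&` ext_triangle_map @^-1` (fst @^-1` B))); last first.
  exact: mu_eT_invariant.
apply: mu_eT_dom; rewrite [in RHS]setIA setIid; apply/seteqP; split => x [Dx].
  by move=> [_ Bx]; split => //=; rewrite ext_triangle_map_fst.
rewrite /= ext_triangle_map_fst => Bx; split => //; split => //=.
by have /Dom_eTP[] := Dx.
Qed.

Lemma measurable_ext_back : measurable_fun setT (@ext_back R m).
Proof.
rewrite (_ : @ext_back R m = (fun x => if branch x.2 then (dual true x.1, back true x.2)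
    else (dual false x.1, back false x.2))); last first.
  by apply/funext => x; rewrite /ext_back; case: branch.
apply: measurable_fun_ifT; first exact: measurable_branch.
  by apply: measurable_fun_pair; apply: measurableT_comp => //;
    [exact: measurable_dual|exact: measurable_back].
by apply: measurable_fun_pair; apply: measurableT_comp => //;
  [exact: measurable_dual|exact: measurable_back].
Qed.

Lemma ext_inj : {in @ms_dom _ X &, injective (ext_triangle_map : X -> X)}.
Proof.
move=> x y /set_mem Dx /set_mem Dy e.
by rewrite -(ext_back_map m0 Dx) e (ext_back_map m0 Dy).
Qed.

(** The image of [A] is the preimage of [A] under the inverse [ext_back]. *)
Lemma measurable_ext_image (A : set X) : ms_measurable A ->
  measurable (ext_triangle_map @` A).
Proof.
move=> [mA AX].
rewrite (_ : _ @` A = Dom_eT N `&` @ext_back R m @^-1` A).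
  apply: measurableI; first exact: measurable_Dom_eT.
  by apply: measurable_preimage => //; exact: measurable_ext_back.
apply/seteqP; split => [_ [x Ax <-]|x [Dx Ax]].
  split; first exact/Dom_eT_map/AX.
  by rewrite /= (ext_back_map m0 (AX _ Ax)).
exists (ext_back x) => //; apply: ext_map_back => //.
by have /Dom_eTP[] := Dx.
Qed.

Lemma measurable_vec_eq d (T : measurableType d) (f g : T -> vec) :
  measurable_fun setT f -> measurable_fun setT g -> measurable [set x | f x = g x].
Proof.
move=> mf mg.
rewrite (_ : [set _ | _] = \bigcap_(i : 'I_m.+1) [set x | (f x)`_i = (g x)`_i]).
  apply: fin_bigcap_measurable => // i _.
  by apply: measurable_eq_fun; apply: (measurableT_comp (measurable_nth _)).
apply/seteqP; split => x /= => [e i _|H]; first by rewrite /= e.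
apply: eq_vec => i im.
exact: (H (Ordinal (im : (i < m.+1)%N)) I).
Qed.

Lemma measurable_lift : measurable_fun setT (@lift R m N).
Proof.
apply: measurable_fun_pair => //.
apply: (@measurable_mktuple _ _ (fun _ l => N / (\sum_(j < m.+1) l`_j))) => _.
apply: measurable_funM => //; apply: (measurableT_comp measurable_invr).
by apply: measurable_sum => i; exact: measurable_nth.
Qed.

Definition approximation (n : nat) (w : paths Y) (c : nat) : R :=
  (iter n ext_triangle_map (lift N (w n))).2`_c.

(** The upper limit is a total and measurable substitute for the limit, which
    exists almost everywhere by [reconstruct]. *)
Definition rebuild (w : paths Y) : X :=
  (w 0%N, [tuple fine (limn_esup (fun n => (approximation n w c)%:E)) | c < m.+1]).

Lemma measurable_rebuild : measurable_fun setT rebuild.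
Proof.
apply: measurable_fun_pair; first exact: measurable_coordinate.
apply/measurable_fun_tnthP => c.
rewrite (_ : _ \o _ =
  fine \o (fun w => limn_esup (fun n => (approximation n w c)%:E))); last first.
  by apply/funext => w /=; rewrite tnth_mktuple.
apply: measurableT_comp => //.
apply: measurable_fun_limn_esup => n; apply/measurable_EFinP.
apply: (measurableT_comp (measurable_nth c)); apply: (measurableT_comp measurable_snd).
apply: measurableT_comp; first by apply: measurable_iter; exact: measurable_ext_triangle_map.
by apply: (measurableT_comp measurable_lift); exact: measurable_coordinate.
Qed.

Lemma rebuild_ae : ms_ae (fun x : X => forall z : nat -> X, z 0%N = x ->
  (forall n, Dom_eT N (z n)) -> (forall n, ext_triangle_map (z n.+1) = z n) ->
  rebuild (fun n => (z n).1) = x).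
Proof.
have : ms_ae (fun x : X => forall c, ~ unbounded_points N c x).
  apply: ms_ae_nat => c; exists (unbounded_points N c); split.
  - exact: measurable_unbounded_points.
  - exact: mu_eT_unbounded.
  - by move=> x /= h; apply: contrapT => nx; apply: h.
apply: ms_aeS => x Dx bounded z z0 Dz zS.
have lim c : (c <= m)%N -> approximation n (fun n => (z n).1) c @[n --> \oo] --> x.2`_c.
  move=> cm; rewrite -z0; apply: (reconstruct m0 N0 Dz zS cm).
  apply: contrapT => nb; apply: (bounded c); split => // M _.
  apply: contrapT => nM; apply: nb; exists M%:R => n; rewrite ltNge; apply/negP => h.
  by apply: nM; exists n => //; rewrite /= -z0.
rewrite /rebuild; case: x Dx z0 bounded lim => l k Dx z0 bounded lim.
congr pair; first by rewrite z0.
apply: eq_vec => c cm.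
rewrite (@nth_mktuple_nat _ _ (fun c =>
  fine (limn_esup (fun n => (approximation n (fun n => (z n).1) c)%:E))))//.
have cv : (approximation n (fun n => (z n).1) c)%:E @[n --> \oo] --> (k`_c)%:E.
  by apply: cvg_EFin; [exact: nearW|exact: lim].
rewrite is_cvg_limn_esupE; last by apply/cvg_ex; eexists; exact: cv.
by rewrite (cvg_lim _ cv).
Qed.

Lemma natural_extension_triangle :
  natural_extension X Y triangle_map ext_triangle_map fst.
Proof.
apply: (@natural_extension_criterion R X Y triangle_map ext_triangle_map fst
  triangle_map_preserving ext_preserving fst_preserving ext_inj measurable_ext_image
  _ _ level _ _ _ _ _ rebuild measurable_rebuild rebuild_ae).
- by move=> x _; exact: ext_triangle_map_fst.
- by move=> l Dl; exists (lift N l) => //; exact: Dom_eT_lift.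
- exact: measurable_level.
- by move=> l [tl _]; have [j] := level_cover tl; exists j.
- move=> j; apply: (le_lt_trans _ (nu_level_fin N0 j)).
  apply: le_measure; rewrite ?inE.
  + by apply: measurableI; [exact: measurable_Dom_T|exact: measurable_level].
  + exact: measurable_level.
  + by move=> ? [].
- rewrite (_ : [set _ | _] =
      [set z : X * X | z.1.1 = z.2.1] `&` [set z : X * X | z.1.2 = z.2.2]).
    by apply: measurableI; apply: measurable_vec_eq;
      apply: measurableT_comp => //; exact: measurableT_comp.
  by apply/seteqP; split => -[[l k] [l' k']] /=; [case=> -> ->|case=> -> ->].
- exact: (measurable_vec_eq measurable_fst measurable_snd).
Qed.

End final.

Theorem theorem5p4 (R : realType) (m : nat) (N : R) :
  (1 < m)%N -> 0 < N ->
  natural_extension (space_eT m N) (space_T m N)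
    triangle_map ext_triangle_map fst.
Proof. by move=> m1; exact: (natural_extension_triangle (ltnW m1)). Qed.
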